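(* Let $h_0$ be a flat left-invariant Lorentzian metric on the Heisenberg Lie group $\mathrm{H}_3(\mathbb{R})$, and let $h_1$ and $h_2$ be the left-invariant Lorentzian metrics on $\mathrm{H}_3(\mathbb{R})$ determined by $$h_1:\quad 1=\langle X_1,X_1\rangle=\langle X_2,X_2\rangle=-\langle X_3,X_3\rangle,\qquad h_2:\quad 1=\langle X_1,X_2\rangle=\langle X_3,X_3\rangle,$$ all other products of the basis vectors $X_1,X_2,X_3$ being zero in each case. Then the isometry groups are \begin{itemize} \item $\mathrm{I}(\mathrm{H}_3(\mathbb{R}),h_0)=\mathrm{H}_3(\mathbb{R})\rtimes\mathrm{O}(2,1)$, \item $\mathrm{I}(\mathrm{H}_3(\mathbb{R}),h_1)=\mathrm{H}_3(\mathbb{R})\rtimes\mathrm{O}(2)$, \item $\mathrm{I}(\mathrm{H}_3(\mathbb{R}),h_2)=\mathrm{H}_3(\mathbb{R})\rtimes\mathrm{O}(1,1)$. \end{itemize} Moreover, both non-flat metrics $h_1$ and $h_2$ are algebraic Ricci solitons.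
   Context: $\mathrm{H}_3(\mathbb{R})$ is the simply connected Lie group with Lie algebra $\mathfrak{h}_3$ having a basis of left-invariant vector fields $X_1,X_2,X_3$ with only non-trivial bracket $[X_1,X_2]=X_3$. Concretely it is $\mathbb{R}^2\oplus\mathbb{R}$ with product $(v,z)\cdot(v',z')=(v+v',z+z'+\tfrac12 v^TJv')$, $J=\begin{pmatrix}0&1\\-1&0\end{pmatrix}$, and $X_1=\partial_x-\tfrac y2\partial_z$, $X_2=\partial_y+\tfrac x2\partial_z$, $X_3=\partial_z$. $\mathrm{I}(N,h)$ denotes the full isometry group of the pseudo-Riemannian manifold $(N,h)$. In the expression $\mathrm{I}(N)=N\rtimes F(N)$ the factor $N$ is the group of left-translations and $F(N)$ is the isotropy subgroup at the identity element of $N$. An algebraic Ricci soliton on $\mathrm{H}_3(\mathbb{R})$ is a left-invariant pseudo-Riemannian metric $g$ whose Ricci operator $\mathrm{Rc}(g):\mathfrak{h}_3\to\mathfrak{h}_3$ satisfies $\mathrm{Rc}(g)=c\,\mathrm{Id}+D$ for some $c\in\mathbb{R}$ and some derivation $D$ of $\mathfrak{h}_3$, i.e. a linear map with $D[x,y]=[Dx,y]+[x,Dy]$ for all $x,y\in\mathfrak{h}_3$.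
   Formalization: For flat h_0, the left translations are not normal in the isometry group (that of Minkowski space), so ⋊ is read there as a product: each isometry is uniquely a left translation after an element of the isotropy group, which is isomorphic to O(2,1); normality is claimed only for h_1, h_2. *)

(* Defs.v *)
From mathcomp Require Import all_boot all_order all_algebra.
From mathcomp Require Import ring.
From mathcomp Require Import all_classical all_reals all_analysis.

Set Implicit Arguments.
Unset Strict Implicit.
Unset Printing Implicit Defensive.

Import Order.TTheory GRing.Theory Num.Theory.
Import numFieldNormedType.Exports.

Local Open Scope classical_set_scope.
Local Open Scope ring_scope.

(* Intended for V finite dimensional: there, continuity of x |-> 'd f x is
   continuity of x |-> 'd f x v for every v. *)

Fixpoint Ck (R : realType) (V W : normedModType R) (k : nat) (f : V -> W)
  : Prop :=
  match k with
  | 0 => continuous f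
  | k'.+1 => (forall x, differentiable f x) /\
             (forall v, Ck k' (fun x => 'd f x v))
  end.

Definition smooth (R : realType) (V W : normedModType R) (f : V -> W) : Prop :=
  forall k, Ck k f.

Definition homeo_on (U V : topologicalType) (A : set U) (B : set V)
    (f : U -> V) : Prop :=
  [/\ set_bij A B f, {within A, continuous f} &
      exists2 g : V -> U, {within B, continuous g} & {in A, cancel f g}].

(* Pseudo-Riemannian metrics on R^(n+1), given by the matrix of the metric in
   the coordinate basis of each tangent space.  Tangent vectors are rows. *)

Section PseudoRiemannian.
Context {R : realType} {n : nat}.
Local Notation E := 'rV[R]_n.+1.
Implicit Types (g : E -> 'M[R]_n.+1) (f : E -> E) (p u v : E).
Implicit Types i j k l : 'I_n.+1.

Definition inner g p u v : R := (u *m g p *m v^T) 0 0.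

Definition pseudo_riemannian g : Prop :=
  smooth g /\ forall p, (g p)^T = g p /\ g p \in unitmx.

Definition preserves g f : Prop :=
  forall p u v, inner g (f p) ('d f p u) ('d f p v) = inner g p u v.

Definition isometries g : set (E -> E) :=
  [set f | [/\ smooth f, preserves g f &
     exists2 f', smooth f' & cancel f f' /\ cancel f' f]].

Definition partial i (a : E -> R) p : R := 'D_(delta_mx 0 i) a p.

(* Levi-Civita connection: nabla_(d_i) d_j = \sum_k (christoffel g k i j) d_k *)
Definition christoffel g k i j p : R :=
  2^-1 * \sum_l invmx (g p) k l *
    (partial i (fun q => g q j l) p + partial j (fun q => g q i l) p
     - partial l (fun q => g q i j) p).

(* R(d_i, d_j) d_k = \sum_l (riemann g l k i j) d_l, where
   R(X, Y) = [nabla_X, nabla_Y] - nabla_[X, Y] *)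
Definition riemann g l k i j p : R :=
  partial i (christoffel g l j k) p - partial j (christoffel g l i k) p
  + \sum_m (christoffel g l i m p * christoffel g m j k p
            - christoffel g l j m p * christoffel g m i k p).

Definition flat g : Prop := forall p l k i j, riemann g l k i j p = 0.

(* Ric(Y, Z) = tr (X |-> R(X, Y) Z) *)
Definition ricci g p : 'M[R]_n.+1 := \matrix_(j, k) \sum_i riemann g i k i j p.

(* The endomorphism u |-> u *m ricci_op g p of the tangent space at p satisfies
   inner g p (u *m ricci_op g p) v = Ric(u, v). *)
Definition ricci_op g p : 'M[R]_n.+1 := ricci g p *m invmx (g p).

End PseudoRiemannian.

Definition sig_mx {R : realType} (p q : nat) : 'M[R]_(p + q) :=
  block_mx 1%:M 0 0 (- 1%:M).

(* O(p, q) for J = sig_mx p q, O(n) for J = 1%:M *)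
Definition orthogonal_group {R : realType} {n : nat} (J : 'M[R]_n) :
  set 'M[R]_n := [set A | A *m J *m A^T = J].

Section Heisenberg.
Context {R : realType}.
Local Notation H3 := 'rV[R]_3.
Local Notation x_ := (@Ordinal 3 0 isT).
Local Notation y_ := (@Ordinal 3 1 isT).
Local Notation z_ := (@Ordinal 3 2 isT).
Implicit Types (p q a u v : H3) (g : H3 -> 'M[R]_3) (G : 'M[R]_3).

Definition dz : H3 := delta_mx 0 z_.

(* v^T J w for the components of u and v in R^2 *)
Definition area u v : R := u 0 x_ * v 0 y_ - u 0 y_ * v 0 x_.

Definition mulH p q : H3 := p + q + (2^-1 * area p q) *: dz.

(* The neutral element is 0, and the coordinate basis of the tangent space
   there is X_1, X_2, X_3: the Lie algebra is 'rV[R]_3 with this bracket. *)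
Definition bracket u v : H3 := area u v *: dz.

Definition derivation (D : 'M[R]_3) : Prop :=
  forall u v, bracket u v *m D = bracket (u *m D) v + bracket u (v *m D).

Definition X1 p : H3 := delta_mx 0 x_ - (p 0 y_ / 2) *: dz.
Definition X2 p : H3 := delta_mx 0 y_ + (p 0 x_ / 2) *: dz.
Definition X3 p : H3 := dz.

Definition frame p : 'M[R]_3 :=
  \matrix_(i < 3) nth 0 [:: X1 p; X2 p; X3 p] i.

Definition left_invariant g : Prop := forall a, preserves g (mulH a).

(* The left-invariant metric with <X_i, X_j> = G i j; see inner_linv. *)
Definition linv_metric G p : 'M[R]_3 :=
  invmx (frame p) *m G *m (invmx (frame p))^T.

Lemma sum3 (W : nmodType) (F : 'I_3 -> W) :
  \sum_i F i = F x_ + F y_ + F z_.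
Proof.
rewrite !big_ord_recl big_ord0 addr0 addrA.
by congr (F _ + F _ + F _); apply/val_inj.
Qed.

Lemma ord3P (P : 'I_3 -> Prop) : P x_ -> P y_ -> P z_ -> forall i, P i.
Proof.
move=> Px Py Pz [[|[|[|//]]] lti3].
- by rewrite (_ : Ordinal _ = x_) //; apply/val_inj.
- by rewrite (_ : Ordinal _ = y_) //; apply/val_inj.
- by rewrite (_ : Ordinal _ = z_) //; apply/val_inj.
Qed.

Lemma mulH_frame p q : mulH p q = p + q *m frame p.
Proof.
rewrite /mulH -addrA; congr (_ + _); apply/rowP.
by apply: ord3P; rewrite !mxE sum3 !mxE /= /area; ring.
Qed.

Lemma frameD p q : frame p *m frame q = frame (p + q).
Proof.
apply/matrixP; apply: ord3P; apply: ord3P; rewrite !mxE sum3 !mxE /=.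
all: by ring.
Qed.

Lemma frame0 : frame 0 = 1%:M.
Proof.
by apply/matrixP; apply: ord3P; apply: ord3P; rewrite !mxE /=; ring.
Qed.

Lemma frame_mulH p q : frame (mulH p q) = frame p *m frame q.
Proof.
rewrite frameD /mulH; apply/matrixP; apply: ord3P; apply: ord3P.
all: by rewrite !mxE /=; ring.
Qed.

Lemma frame_unit p : frame p \in unitmx.
Proof.
have : frame p *m frame (- p) = 1%:M by rewrite frameD subrr frame0.
by case/mulmx1_unit.
Qed.

Lemma invmx_frame p : invmx (frame p) = frame (- p).
Proof.
by rewrite -[RHS](mulKmx (frame_unit p)) frameD subrr frame0 mulmx1.
Qed.

Lemma inner_linv G p (i j : 'I_3) :
  inner (linv_metric G) p (row i (frame p)) (row j (frame p)) = G i j.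
Proof.
have rowV k : row k (frame p) *m invmx (frame p) = delta_mx 0 k.
  by rewrite -row_mul mulmxV ?frame_unit // row1.
rewrite /inner /linv_metric !mulmxA rowV -mulmxA -trmx_mul rowV.
by rewrite -rowE trmx_delta -colE !mxE.
Qed.

Lemma diff_mulH a p : ('d (mulH a) p : H3 -> H3) = mulmx^~ (frame a).
Proof.
pose L : {linear H3 -> H3} := mulmxr (frame a).
have cL : continuous L.
  have -> : (L : H3 -> H3) =
      \sum_i (fun q : H3 => q 0 i *: row i (frame a)).
    by apply/funext => q; rewrite /L /= mulmx_sum_row fct_sumE.
  move=> q; apply: differentiable_continuous; apply: differentiable_sum => i.
  by apply: differentiableZl; apply: differentiable_coord.
have dL : is_diff p L L.
  by apply: DiffDef; [exact: linear_differentiable|exact: diff_lin].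
have dmul : is_diff p ((cst a : H3 -> H3) + (L : H3 -> H3)) (0 + (L : H3 -> H3)).
  exact: is_diffD.
have -> : mulH a = (cst a : H3 -> H3) + (L : H3 -> H3).
  by apply/funext => q; rewrite mulH_frame.
by rewrite diff_val add0r.
Qed.

Lemma linv_metric_left_invariant G : left_invariant (linv_metric G).
Proof.
move=> a p u v; rewrite diff_mulH /inner /linv_metric !invmx_frame.
have frK (w : H3) : w *m frame a *m frame (- mulH a p) = w *m frame (- p).
  rewrite -invmx_frame frame_mulH frameD invmx_frame -mulmxA frameD.
  by rewrite opprD addrA subrr add0r.
rewrite !mulmxA frK -[in LHS]mulmxA -trmx_mul frK.
by rewrite trmx_mul mulmxA.
Qed.

Definition lorentzian g : Prop :=
  pseudo_riemannian g /\
  forall p, exists2 P : 'M[R]_3, P \in unitmx & g p = P *m sig_mx 2 1 *m P^T.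

Definition h1 : H3 -> 'M[R]_3 :=
  linv_metric (delta_mx x_ x_ + delta_mx y_ y_ - delta_mx z_ z_).

Definition h2 : H3 -> 'M[R]_3 :=
  linv_metric (delta_mx x_ y_ + delta_mx y_ x_ + delta_mx z_ z_).

Definition isotropy g : set (H3 -> H3) := [set f | isometries g f /\ f 0 = 0].

(* I(N) = N F(N) with F(N) isomorphic to K: left translations are isometries,
   every isometry is uniquely a left translation after an isometry fixing the
   identity, the isotropy group is isomorphic to K, and the decomposition is
   compatible with the topology of I(N), which is the compact-open one.  The
   isomorphism K -> F(N) is then one of Lie groups, as continuous homomorphisms
   of Lie groups are smooth.  Normality of N is not part of it: for a flat
   Lorentzian metric I(N) is the isometry group of Minkowski 3-space, in which
   the left translations are not normal. *)
Definition isometry_product n g (K : set 'M[R]_n) : Prop :=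
  exists Phi : 'M[R]_n -> H3 -> H3,
  [/\ forall a, isometries g (mulH a),
      set_bij K (isotropy g) Phi,
      {in K &, forall A B, Phi (A *m B) = Phi A \o Phi B} &
      homeo_on ([set: H3] `*` K)
               (isometries g : set {compact-open, H3 -> H3})
               (fun aA => mulH aA.1 \o Phi aA.2)].

Definition left_translations_normal g : Prop :=
  forall f a, isometries g f -> exists b, f \o mulH a = mulH b \o f.

Definition isometry_semidirect n g (K : set 'M[R]_n) : Prop :=
  isometry_product g K /\ left_translations_normal g.

Definition algebraic_ricci_soliton g : Prop :=
  [/\ pseudo_riemannian g, left_invariant g &
      exists c : R, exists2 D, derivation D & ricci_op g 0 = c%:M + D].

End Heisenberg.

(* Main.v *)
From HB Require Import structures.
Require Import Defs.
From mathcomp Require Import all_boot all_order all_algebra.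
From mathcomp Require Import ring lra.
From mathcomp Require Import all_classical all_reals all_analysis.

(* Nonflat metrics.  Let M be the differential of an isometry f, expressed in
   the left-invariant frame X_1, X_2, X_3 at both ends.  Since f preserves the
   metric and pulls back the structure equations, Koszul's argument expresses
   the derivatives of M polynomially in M, and commuting two of them shows that
   f preserves the curvature.  The curvature singles out the plane of X_1 and
   X_2, so f preserves the line of X_3; the rest of M is then constant, and an
   isometry fixing 0 is a linear automorphism (N, det N) of the group.

   Flat metrics.  The curvature of a left-invariant metric satisfies
   Ric(X_3, X_3) = G_33^3 / (2 det G), so flatness forces X_3 to be null.  The
   metric can then be integrated explicitly: a polynomial diffeomorphism, with
   polynomial inverse, carries it to a constant metric, the isometries of which
   are affine, again by Koszul's argument. *)

Set Implicit Arguments.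
Unset Strict Implicit.
Unset Printing Implicit Defensive.

Import Order.TTheory GRing.Theory Num.Theory.
Import numFieldNormedType.Exports.

Local Open Scope classical_set_scope.
Local Open Scope ring_scope.

(** * Smooth maps *)

(** An isometry is only a smooth bijection here; nothing relates it to the group law in advance, so
    every algebraic property has to come from differential equations for its Jacobian. The curvature
    is useful because in dimension 3 the curvature of [h1] and [h2] is a multiple of the tensor
    built from the metric alone, which any linear isometry respects, plus a term of rank one carried
    by the bivector of X_1 and X_2. An isometry must therefore respect that second term on its own,
    and its kernel singles out X_3. Both metrics are instances of one Gram matrix [G] with
    [G *m G = 1], determinant -1 and X_3 orthogonal to X_1 and X_2; a change of basis [Q] of the
    plane then brings O(2) and O(1,1) to standard form. For the topology it is enough that the
    matrix of an isotropy element can be read off from the values of the isometry at finitely many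
    points, since evaluation is continuous for the compact-open topology. *)

Section CkTheory.
Context {R : realType}.
Implicit Types (V W : normedModType R).

Lemma CkW V W k (f : V -> W) : Ck k.+1 f -> Ck k f.
Proof.
elim: k f => [|k IH] f [df cf].
  by move=> x; exact: differentiable_continuous.
by split=> // v; exact/IH/cf.
Qed.

Lemma smooth_diff V W (f : V -> W) p : smooth f -> differentiable f p.
Proof. by move=> /(_ 1%N) []. Qed.

Lemma smooth_continuous V W (f : V -> W) : smooth f -> continuous f.
Proof. exact: (fun sf => sf 0%N). Qed.

Lemma smooth_d V W (f : V -> W) v : smooth f -> smooth (fun p => 'd f p v).
Proof. by move=> sf k; case: (sf k.+1) => _; apply. Qed.

Lemma Ck_cst V W k (c : W) : Ck k (fun _ : V => c).
Proof.
elim: k c => [|k IH] c; first exact: cst_continuous.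
split=> [x|v]; first exact: differentiable_cst.
under eq_fun do rewrite (diff_cst c) /=.
exact: IH.
Qed.

Lemma Ck_lin V W W' k (L : {linear W -> W'}) (f : V -> W) :
  continuous L -> Ck k f -> Ck k (fun x => L (f x)).
Proof.
move=> cL; elim: k f => [|k IH] f.
  by move=> cf x; apply: continuous_comp; [exact: cf|exact: cL].
case=> df cf.
have dL x : differentiable L x by exact: linear_differentiable.
split=> [x|v]; first exact: differentiable_comp.
under eq_fun => x do rewrite (diff_comp (df x) (dL _)) (diff_lin _ cL) /=.
by apply: IH; exact: cf.
Qed.

Lemma CkD V W k (f g : V -> W) :
  Ck k f -> Ck k g -> Ck k (fun x => f x + g x).
Proof.
elim: k f g => [|k IH] f g.
  by move=> cf cg x; apply: continuousD; [exact: cf|exact: cg].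
move=> [df cf] [dg cg]; split=> [x|v]; first exact: differentiableD.
under eq_fun do rewrite (diffD (df _) (dg _)).
by apply: IH; [exact: cf|exact: cg].
Qed.

Lemma CkM V k (a b : V -> R) : Ck k a -> Ck k b -> Ck k (fun x => a x * b x).
Proof.
elim: k a b => [|k IH] a b.
  by move=> ca cb x; apply: continuousM; [exact: ca|exact: cb].
move=> Ca Cb; case: (Ca) (Cb) => [da ca] [db cb].
split=> [x|v]; first exact: differentiableM.
under eq_fun do rewrite (diffM (da _) (db _)).
apply: CkD; apply: IH.
- exact: CkW Ca.
- exact: cb.
- exact: CkW Cb.
- exact: ca.
Qed.

End CkTheory.

Section SmoothTheory.
Context {R : realType}.
Implicit Types (V W : normedModType R).

Lemma smooth_cst V W (c : W) : smooth (fun _ : V => c).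
Proof. by move=> k; exact: Ck_cst. Qed.

Lemma smooth_lin V W W' (L : {linear W -> W'}) (f : V -> W) :
  continuous L -> smooth f -> smooth (fun x => L (f x)).
Proof. by move=> cL sf k; exact: Ck_lin. Qed.

Lemma smoothD V W (f g : V -> W) :
  smooth f -> smooth g -> smooth (fun x => f x + g x).
Proof. by move=> sf sg k; exact: CkD. Qed.

Lemma smoothM V (a b : V -> R) :
  smooth a -> smooth b -> smooth (fun x => a x * b x).
Proof. by move=> sa sb k; exact: CkM. Qed.

Lemma smoothN V (a : V -> R) : smooth a -> smooth (fun x => - a x).
Proof.
move=> sa; under eq_fun do rewrite -mulN1r.
by apply: smoothM => //; exact: smooth_cst.
Qed.

Lemma smoothB V (a b : V -> R) :
  smooth a -> smooth b -> smooth (fun x => a x - b x).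
Proof. by move=> sa sb; apply: smoothD => //; exact: smoothN. Qed.

Lemma smooth_sum V W (I : Type) (r : seq I) (P : pred I) (F : I -> V -> W) :
  (forall i, smooth (F i)) -> smooth (fun x => \sum_(i <- r | P i) F i x).
Proof.
move=> sF; elim: r => [|i r IH].
  by under eq_fun do rewrite big_nil; exact: smooth_cst.
under eq_fun do rewrite big_cons.
by case: (P i) => //; apply: smoothD.
Qed.

Lemma smooth_id V : smooth (@id V).
Proof.
case=> [|k]; first by move=> x; exact: cvg_id.
split=> // v; under eq_fun => x do rewrite diff_val.
exact: Ck_cst.
Qed.

(** Named so that scaling a fixed vector carries a linear structure, to which [smooth_lin] applies;
    [entry] below is named for the same reason. *)
Definition scale_by W (w : W) (c : R) : W := c *: w.

Fact scale_by_is_linear W (w : W) : linear (scale_by w).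
Proof. by move=> c x y; rewrite /scale_by scalerDl scalerA. Qed.
HB.instance Definition _ W (w : W) :=
  GRing.isLinear.Build R R W _ (scale_by w) (scale_by_is_linear w).

Lemma smooth_scalel V W (a : V -> R) (w : W) :
  smooth a -> smooth (fun x => a x *: w).
Proof.
move=> sa; apply: (smooth_lin (L := scale_by w)) => //.
exact: scalel_continuous.
Qed.

Section Matrix.
Context {m n : nat}.

Definition entry (i : 'I_m) (j : 'I_n) (A : 'M[R]_(m, n)) : R := A i j.

Fact entry_is_linear i j : linear (entry i j).
Proof. by move=> c A B; rewrite /entry !mxE. Qed.
HB.instance Definition _ i j :=
  GRing.isLinear.Build R 'M[R]_(m, n) R _ (entry i j) (entry_is_linear i j).

Lemma entry_continuous i j : continuous (entry i j).
Proof. exact: coord_continuous. Qed.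

End Matrix.

Lemma smooth_mxP V m n (f : V -> 'M[R]_(m.+1, n.+1)) :
  smooth f <-> forall i j, smooth (fun x => f x i j).
Proof.
split=> [sf i j|sf].
  by apply: (smooth_lin (L := entry i j)) => //; exact: entry_continuous.
have -> : f = fun x => \sum_i \sum_j f x i j *: delta_mx i j.
  by apply/funext => x; exact: matrix_sum_delta.
apply: smooth_sum => i; apply: smooth_sum => j.
exact/smooth_scalel/sf.
Qed.

Lemma diff_mxE V m n (f : V -> 'M[R]_(m.+1, n.+1)) p v i j :
  differentiable f p -> 'd f p v i j = 'd (fun x => f x i j) p v.
Proof.
move=> df; have cL := @entry_continuous m.+1 n.+1 i j.
have dL q : differentiable (entry i j) q by exact: linear_differentiable.
by rewrite (diff_comp df (dL _)) (diff_lin _ cL).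
Qed.

End SmoothTheory.

Section Partials.
Context {R : realType} {n : nat}.
Local Notation E := 'rV[R]_n.+1.
Implicit Types (a b : E -> R) (p v : E).

Lemma partialE a i p : smooth a -> partial i a p = 'd a p (delta_mx 0 i).
Proof. by move=> sa; rewrite /partial deriveE//; exact: smooth_diff. Qed.

Lemma diff_partial a p v :
  smooth a -> 'd a p v = \sum_i v 0 i * partial i a p.
Proof.
move=> sa; rewrite [v in LHS]row_sum_delta linear_sum.
by apply: eq_bigr => i _; rewrite linearZ partialE.
Qed.

Lemma smooth_partial i a : smooth a -> smooth (partial i a).
Proof.
move=> sa; rewrite (_ : partial i a = fun p => 'd a p (delta_mx 0 i)).
  exact: smooth_d.
by apply/funext => p; rewrite partialE.
Qed.

Lemma smooth_coord i : smooth (fun p : E => p 0 i).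
Proof. by move: i; apply: (smooth_mxP _).1; exact: smooth_id. Qed.

Lemma partial_cst i c p : partial i (fun=> c) p = 0 :> R.
Proof. by rewrite partialE ?(diff_cst c)//; exact: smooth_cst. Qed.

Lemma partial_coord i j p :
  partial i (fun q : E => q 0 j) p = (j == i)%:R.
Proof.
rewrite partialE; last exact: smooth_coord.
by rewrite -diff_mxE// diff_val mxE eqxx.
Qed.

Lemma partialD i a b p : smooth a -> smooth b ->
  partial i (fun q => a q + b q) p = partial i a p + partial i b p.
Proof.
move=> sa sb; rewrite !partialE//; last exact: smoothD.
by rewrite (diffD (smooth_diff p sa) (smooth_diff p sb)).
Qed.

Lemma partialM i a b p : smooth a -> smooth b ->
  partial i (fun q => a q * b q) p = a p * partial i b p + b p * partial i a p.
Proof.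
move=> sa sb; rewrite !partialE//; last exact: smoothM.
by rewrite (diffM (smooth_diff p sa) (smooth_diff p sb)).
Qed.

Lemma partialN i a p : smooth a ->
  partial i (fun q => - a q) p = - partial i a p.
Proof.
move=> sa; rewrite !partialE//; last exact: smoothN.
by rewrite (diffN (smooth_diff p sa)).
Qed.

Lemma partialB i a b p : smooth a -> smooth b ->
  partial i (fun q => a q - b q) p = partial i a p - partial i b p.
Proof. by move=> sa sb; rewrite partialD ?partialN//; exact: smoothN. Qed.

Lemma partialZ i c a p : smooth a ->
  partial i (fun q => c * a q) p = c * partial i a p.
Proof.
by move=> sa; rewrite partialM ?partial_cst ?mulr0 ?addr0//; exact: smooth_cst.
Qed.

Lemma partial_sum i (I : Type) (r : seq I) (P : pred I) (F : I -> E -> R) p :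
  (forall k, smooth (F k)) ->
  partial i (fun q => \sum_(k <- r | P k) F k q) p =
  \sum_(k <- r | P k) partial i (F k) p.
Proof.
move=> sF; elim: r => [|k r IH].
  by under eq_fun do rewrite big_nil; rewrite partial_cst big_nil.
under eq_fun do rewrite big_cons.
rewrite big_cons; case: (P k) => //.
by rewrite partialD ?IH//; exact: smooth_sum.
Qed.

End Partials.

Section Composition.
Context {R : realType} {m n : nat}.
Local Notation E := 'rV[R]_m.+1.
Local Notation F := 'rV[R]_n.+1.

Lemma smooth_rowP l (V : normedModType R) (f : V -> 'rV[R]_l.+1) :
  smooth f <-> forall j, smooth (fun p => f p 0 j).
Proof.
by rewrite smooth_mxP; split=> [sf j|sf i j]; rewrite ?ord1; exact: sf.
Qed.

(** The induction on the order keeps [a] general: the chain rule replaces [a] by its partial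
    derivatives, multiplied by components of the differential of [f]. *)
Lemma smooth_comp1 (a : F -> R) (f : E -> F) :
  smooth a -> smooth f -> smooth (fun p => a (f p)).
Proof.
move=> sa sf k; elim: k a sa => [|k IH] a sa.
  by move=> x; apply: continuous_comp; apply: smooth_continuous.
have da q : differentiable a q by exact: smooth_diff.
have df q : differentiable f q by exact: smooth_diff.
split=> [x|v]; first exact: differentiable_comp.
under eq_fun => x do rewrite (diff_comp (df x) (da _)) /= diff_partial//.
(* [smooth_sum] speaks of all orders at once, whereas the induction hypothesis controls order [k]
   only. *)
have Csum (r : seq 'I_n.+1) (g : 'I_n.+1 -> E -> R) :
    (forall j, Ck k (g j)) -> Ck k (fun x => \sum_(j <- r) g j x).
  move=> Cg; elim: r => [|j r IHr].
    by under eq_fun do rewrite big_nil; exact: Ck_cst.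
  by under eq_fun do rewrite big_cons; exact: CkD.
apply: Csum => j; apply: CkM; last exact/IH/smooth_partial.
by have := smooth_d v sf => /smooth_rowP/(_ j)/(_ k).
Qed.

Lemma smooth_comp l (g : F -> 'rV[R]_l.+1) (f : E -> F) :
  smooth g -> smooth f -> smooth (g \o f).
Proof.
move=> /smooth_rowP sg sf; apply/smooth_rowP => j.
exact: (smooth_comp1 (a := fun q => g q 0 j)).
Qed.

End Composition.

(** * Symmetry of second derivatives *)

Section Schwarz.
Context {R : realType} {n : nat}.
Local Notation E := 'rV[R]_n.+1.
Implicit Types (a b : E -> R) (p v : E).

Lemma is_derive_line a i p (s : R) : smooth a ->
  is_derive s 1 (fun t : R => a (t *: delta_mx 0 i + p))
    (partial i a (s *: delta_mx 0 i + p)).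
Proof.
move=> sa; set e : E := delta_mx 0 i.
have dl : is_diff s (fun t : R => t *: e + p) (fun t => t *: e).
  rewrite -[X in is_diff _ _ X]addr0.
  exact: (@is_diffD _ _ _ (fun t : R => t *: e) (cst p)).
have da q : differentiable a q by exact: smooth_diff.
have dal : differentiable (a \o (fun t : R => t *: e + p)) s.
  by apply: differentiable_comp.
apply: DeriveDef; first exact: diff_derivable.
by rewrite deriveE// diff_comp//= diff_val scale1r partialE.
Qed.

Lemma second_difference a i j p (h : R) : smooth a -> 0 < h ->
  let ei := delta_mx 0 i in let ej := delta_mx 0 j in
  exists s t : R, [/\ 0 < s < h, 0 < t < h &
    a (h *: ei + (h *: ej + p)) - a (h *: ei + p) - (a (h *: ej + p) - a p) =
    h ^+ 2 * partial j (partial i a) (t *: ej + (s *: ei + p))].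
Proof.
move=> sa h0 ei ej.
have mvt (b : R -> R) (db : R -> R) : (forall s : R, is_derive s 1 b (db s)) ->
    exists2 s, 0 < s < h & b h - b 0 = db s * h.
  move=> Db; have [|s] := @MVT R b db 0 h h0 => //.
    apply: continuous_subspaceT => x; apply: differentiable_continuous.
    by apply/derivable1_diffP; case: (Db x).
  by rewrite in_itv/= subr0 => sh bE; exists s.
have Dg (s : R) : is_derive s 1
    (fun t => a (t *: ei + (h *: ej + p)) - a (t *: ei + p))
    (partial i a (s *: ei + (h *: ej + p)) - partial i a (s *: ei + p)).
  by apply: is_deriveB; exact: is_derive_line.
have [s sh] := mvt _ _ Dg; rewrite scale0r !add0r => ->.
have Dk (t : R) : is_derive t 1 (fun t => partial i a (t *: ej + (s *: ei + p)))
    (partial j (partial i a) (t *: ej + (s *: ei + p))).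
  exact/is_derive_line/smooth_partial.
have [t th] := mvt _ _ Dk; rewrite scale0r !add0r => kE.
exists s, t; split=> //.
rewrite [s *: ei + (_ + _)]addrCA kE. ring.
Qed.

(** The mean value theorem gives different intermediate points for the two mixed derivatives, so the
    values are compared at two points near [p]. *)
Lemma eq_of_arbitrarily_close (a b : E -> R) p :
  continuous a -> continuous b ->
  (forall d : R, 0 < d -> exists q q', [/\ ball p d q, ball p d q' & a q = b q']) ->
  a p = b p.
Proof.
move=> ca cb ab; apply/eqP; rewrite -subr_eq0 -normr_le0.
apply/ler_addgt0Pl => e e0; rewrite addr0.
have e2 : 0 < e / 2 by rewrite divr_gt0.
have [d /= d0 ad] := (nbhs_ballP _ _).1 ((cvgrPdist_lt _ _).1 (ca p) _ e2).
have [d' /= d'0 bd] := (nbhs_ballP _ _).1 ((cvgrPdist_lt _ _).1 (cb p) _ e2).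
have [|q [q' [pq pq' abq]]] := ab (Num.min d d'); first by rewrite lt_min d0.
have {ad} := ad _ (le_ball _ pq); have {bd} := bd _ (le_ball _ pq').
rewrite ge_min lexx orbT ge_min lexx => /(_ isT) bq /(_ isT) aq.
rewrite -(subrKA (a q)) (le_trans (ler_normD _ _))// (splitr e) ltW// ltrD//.
by rewrite distrC abq.
Qed.

Theorem partialC i j a p : smooth a ->
  partial i (partial j a) p = partial j (partial i a) p.
Proof.
move=> sa; apply/esym/eq_of_arbitrarily_close.
- by apply: smooth_continuous; do 2!apply: smooth_partial.
- by apply: smooth_continuous; do 2!apply: smooth_partial.
(* Intermediate points differ from [p] by two steps shorter than [h] along unit vectors, hence by
   less than [d]. *)
move=> d d0; pose h := d / 2.
have h0 : 0 < h by rewrite divr_gt0.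
have hball (k l : 'I_n.+1) (s t : R) : 0 < s < h -> 0 < t < h ->
    ball p d (t *: delta_mx 0 l + (s *: delta_mx 0 k + p)).
  move=> /andP[s0 sh] /andP[t0 th]; rewrite -ball_normE /ball_/= distrC addrA addrK.
  have nd (m : 'I_n.+1) : `|delta_mx 0 m : E| <= 1.
    rewrite [leLHS]/Num.norm/= mx_normrE bigmax_le// => -[u w] _ /=.
    by rewrite mxE; case: (_ && _); rewrite ?normr1 ?normr0.
  rewrite (le_lt_trans (ler_normD _ _))// !normrZ !gtr0_norm//.
  rewrite (@le_lt_trans _ _ (t + s))//.
    by rewrite lerD// ler_piMr// ltW.
  by rewrite (splitr d) ltrD.
have [s [t [sh th DA]]] := second_difference i j p sa h0.
have [s' [t' [sh' th' DB]]] := second_difference j i p sa h0.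
exists (t *: delta_mx 0 j + (s *: delta_mx 0 i + p)).
exists (t' *: delta_mx 0 i + (s' *: delta_mx 0 j + p)).
split; [exact: hball|exact: hball|].
have h20 : h ^+ 2 != 0 by rewrite expf_neq0// gt_eqF.
have swap (x y z w : R) : x - y - (z - w) = x - z - (y - w) by ring.
(* The second difference is symmetric in the two directions, so both mixed derivatives, times
   [h ^+ 2], equal the same number. *)
by move: DB; rewrite addrCA swap DA => /(mulfI h20).
Qed.

(** Mean value theorem on the segment from 0 to [p]. *)
Lemma partial_eq0_cst a p : smooth a -> (forall i q, partial i a q = 0) ->
  a p = a 0.
Proof.
move=> sa a0.
have Da (s : R) : is_derive s 1 (fun t : R => a (t *: p)) 0.
  have dl : is_diff s (fun t : R => t *: p) (fun t => t *: p).
    exact: is_diff_scalel.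
  have da q : differentiable a q by exact: smooth_diff.
  have dal : differentiable (a \o (fun t : R => t *: p)) s.
    exact: differentiable_comp.
  apply: DeriveDef; first exact: diff_derivable.
  rewrite deriveE// diff_comp//= diff_partial// big1// => i _.
  by rewrite a0 mulr0.
have [|s _] := @MVT R _ _ 0 1 ltr01 (fun x _ => Da x).
  apply: continuous_subspaceT => x; apply: differentiable_continuous.
  by apply/derivable1_diffP; case: (Da x).
by rewrite scale1r scale0r mul0r => /eqP; rewrite subr_eq0 => /eqP.
Qed.

Lemma eq_partial a b : smooth a -> smooth b -> a 0 = b 0 ->
  (forall i p, partial i a p = partial i b p) -> a = b.
Proof.
move=> sa sb ab0 ab; apply/funext => p; apply/eqP; rewrite -subr_eq0.
rewrite (@partial_eq0_cst (fun q => a q - b q)) ?ab0 ?subrr//.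
  exact: smoothB.
by move=> i q; rewrite partialB// ab subrr.
Qed.

End Schwarz.

Local Opaque diff derive partial.

(** * Metrics and derivations *)

Section Jacobian.
Context {R : realType}.

Definition jac m n (f : 'rV[R]_m.+1 -> 'rV[R]_n.+1) p : 'M[R]_(m.+1, n.+1) :=
  \matrix_(i, j) partial i (fun q => f q 0 j) p.

Lemma diff_jac m n (f : 'rV[R]_m.+1 -> 'rV[R]_n.+1) p v :
  smooth f -> 'd f p v = v *m jac f p.
Proof.
move=> sf; apply/rowP => j; rewrite diff_mxE; last exact: smooth_diff.
rewrite diff_partial; last exact: (smooth_rowP _).1.
by rewrite mxE; apply: eq_bigr => i _; rewrite mxE.
Qed.

Lemma bilin_mx_inj m (A B : 'M[R]_m) :
  (forall u v : 'rV_m, (u *m A *m v^T) 0 0 = (u *m B *m v^T) 0 0) -> A = B.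
Proof.
move=> AB; apply/matrixP => i j.
have := AB (delta_mx 0 i) (delta_mx 0 j).
by rewrite !trmx_delta -!rowE -!colE !mxE.
Qed.

Context {n : nat}.
Local Notation E := 'rV[R]_n.+1.
Implicit Types (g : E -> 'M[R]_n.+1) (f : E -> E) (p u v : E).

(** [preserves g f] is the case of a single metric; two metrics are needed for maps onto a space
    with constant metric. *)
Definition pulls_back f g g' : Prop :=
  forall p u v, inner g' (f p) ('d f p u) ('d f p v) = inner g p u v.

Lemma pulls_back_jac f g g' : smooth f ->
  pulls_back f g g' <-> forall p, jac f p *m g' (f p) *m (jac f p)^T = g p.
Proof.
move=> sf; split=> [pf p|pf p u v].
  apply: bilin_mx_inj => u v; rewrite -[RHS](pf p u v) /inner !diff_jac//.
  by rewrite trmx_mul !mulmxA.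
by rewrite /inner !diff_jac// -(pf p) trmx_mul !mulmxA.
Qed.

Lemma pulls_back_comp f f' g g' g'' : smooth f -> smooth f' ->
  pulls_back f g g' -> pulls_back f' g' g'' -> pulls_back (f' \o f) g g''.
Proof.
move=> sf sf' pf pf' p u v.
by rewrite (diff_comp (smooth_diff p sf) (smooth_diff _ sf'))/= pf' pf.
Qed.

Lemma pulls_back_inv f f' g g' : smooth f -> smooth f' -> cancel f' f ->
  pulls_back f g g' -> pulls_back f' g' g.
Proof.
move=> sf sf' ff' pf p u v.
have fK w : 'd f (f' p) ('d f' p w) = w.
    have cE := diff_comp (smooth_diff p sf') (smooth_diff (f' p) sf).
    have idE : f \o f' = id by apply/funext => q; exact: ff'.
    rewrite -[LHS](congr1 (fun L : E -> E => L w) cE) idE.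
    by rewrite diff_val.
have abstr (D D' : E -> E -> E) :
    (forall p u v, inner g' (f p) (D p u) (D p v) = inner g p u v) ->
    (forall w, D (f' p) (D' p w) = w) ->
    inner g (f' p) (D' p u) (D' p v) = inner g' p u v.
  by move=> DP DK; rewrite -DP !DK ff'.
exact: (abstr (fun q w => 'd f q w) (fun q w => 'd f' q w) pf fK).
Qed.

Lemma isometries_comp g f f' :
  isometries g f -> isometries g f' -> isometries g (f \o f').
Proof.
move=> [sf pf [h sh [fK hK]]] [sf' pf' [h' sh' [fK' hK']]]; split.
- exact: smooth_comp sf sf'.
- exact: pulls_back_comp sf' sf pf' pf.
- exists (h' \o h); first exact: smooth_comp sh' sh.
  by split=> q /=; rewrite ?fK ?fK' ?hK' ?hK.
Qed.

End Jacobian.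

Section VectorFields.
Context {R : realType} {n : nat}.
Local Notation E := 'rV[R]_n.+1.
Implicit Types (X Y : E -> E) (a b : E -> R) (p q : E).

Definition along X a p : R := \sum_i X p 0 i * partial i a p.

Lemma smooth_along X a : smooth X -> smooth a -> smooth (along X a).
Proof.
move=> sX sa; apply: smooth_sum => i; apply: smoothM; last exact: smooth_partial.
exact: (smooth_rowP _).1.
Qed.

Lemma along_partial i a p : along (fun=> delta_mx 0 i) a p = partial i a p.
Proof.
rewrite /along (bigD1 i)//= big1 ?addr0 => [|j ji]; rewrite mxE ?eqxx ?mul1r//.
by rewrite (negbTE ji) mul0r.
Qed.

Lemma along_cst X c p : along X (fun=> c) p = 0 :> R.
Proof. by rewrite /along big1// => i _; rewrite partial_cst mulr0. Qed.

Lemma alongD X a b p : smooth a -> smooth b ->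
  along X (fun q => a q + b q) p = along X a p + along X b p.
Proof.
move=> sa sb; rewrite /along -big_split; apply: eq_bigr => i _ /=.
by rewrite partialD// mulrDr.
Qed.

Lemma alongM X a b p : smooth a -> smooth b ->
  along X (fun q => a q * b q) p = along X a p * b p + a p * along X b p.
Proof.
move=> sa sb; rewrite /along mulr_suml mulr_sumr -big_split.
by apply: eq_bigr => i _ /=; rewrite partialM//; ring.
Qed.

Lemma along_sum X (I : Type) (r : seq I) (P : pred I) (F : I -> E -> R) p :
  (forall k, smooth (F k)) ->
  along X (fun q => \sum_(k <- r | P k) F k q) p =
  \sum_(k <- r | P k) along X (F k) p.
Proof.
move=> sF; rewrite /along exchange_big/=; apply: eq_bigr => i _.
by rewrite partial_sum// mulr_sumr.
Qed.

Lemma along_commutator X Y a p : smooth X -> smooth Y -> smooth a ->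
  along X (along Y a) p - along Y (along X a) p =
  \sum_i (along X (fun q => Y q 0 i) p - along Y (fun q => X q 0 i) p)
          * partial i a p.
Proof.
move=> sX sY sa.
have expand U V : smooth U -> smooth V -> along U (along V a) p =
    \sum_i along U (fun q => V q 0 i) p * partial i a p
    + \sum_i \sum_j V p 0 i * U p 0 j * partial j (partial i a) p.
  move=> sU sV.
  have sVi i : smooth (fun q => V q 0 i) by exact: (smooth_rowP _).1.
  have sVa i : smooth (fun q => V q 0 i * partial i a q).
    by apply: smoothM => //; exact: smooth_partial.
  transitivity (\sum_i along U (fun q => V q 0 i * partial i a q) p).
    exact: (@along_sum U _ _ _ (fun i q => V q 0 i * partial i a q)).
  rewrite -big_split; apply: eq_bigr => i _ /=.
  rewrite alongM//; last exact: smooth_partial.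
  by congr (_ + _); rewrite /along mulr_sumr; apply: eq_bigr => j _; ring.
rewrite !expand//.
(* The second-order terms of the two iterated derivatives agree by [partialC] and cancel, which
   leaves a first-order operator. *)
rewrite [X in _ - (_ + X)](_ : _ =
    \sum_i \sum_j Y p 0 i * X p 0 j * partial j (partial i a) p); last first.
  rewrite exchange_big; apply: eq_bigr => i _; apply: eq_bigr => j _ /=.
  by rewrite partialC// [X p 0 j * _]mulrC.
rewrite [in RHS](eq_bigr (fun i => along X (fun q => Y q 0 i) p * partial i a p
   - along Y (fun q => X q 0 i) p * partial i a p)); last first.
  by move=> i _; rewrite mulrBl.
rewrite sumrB; ring.
Qed.

Definition along_mx X m l (M : E -> 'M[R]_(m, l)) p : 'M[R]_(m, l) :=
  \matrix_(i, j) along X (fun q => M q i j) p.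

Definition smooth_entries m l (M : E -> 'M[R]_(m, l)) : Prop :=
  forall i j, smooth (fun q => M q i j).

Lemma along_mx_cst X m l (A : 'M[R]_(m, l)) p : along_mx X (fun=> A) p = 0.
Proof. by apply/matrixP => i j; rewrite !mxE along_cst. Qed.

Lemma along_mxT X m l (M : E -> 'M[R]_(m, l)) p :
  along_mx X (fun q => (M q)^T) p = (along_mx X M p)^T.
Proof.
apply/matrixP => i j; rewrite !mxE; congr (along X _ p).
by apply/funext => q; rewrite mxE.
Qed.

Lemma smooth_entries_mul m l k (M : E -> 'M[R]_(m, l)) (N : E -> 'M[R]_(l, k)) :
  smooth_entries M -> smooth_entries N -> smooth_entries (fun q => M q *m N q).
Proof.
move=> sM sN i j; under eq_fun do rewrite mxE.
by apply: smooth_sum => t; exact: smoothM.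
Qed.

Lemma along_mxM X m l k (M : E -> 'M[R]_(m, l)) (N : E -> 'M[R]_(l, k)) p :
  smooth_entries M -> smooth_entries N ->
  along_mx X (fun q => M q *m N q) p = along_mx X M p *m N p + M p *m along_mx X N p.
Proof.
move=> sM sN; apply/matrixP => i j; rewrite !mxE.
under eq_fun do rewrite mxE.
rewrite along_sum => [|t]; last exact: smoothM.
by rewrite -big_split; apply: eq_bigr => t _; rewrite alongM// !mxE.
Qed.

(** The derivative of the constant [M q *m S *m (M q)^T] is the sum of the left-hand matrix and its
    transpose. *)
Lemma along_mx_isometry X m (S : 'M[R]_m) (M : E -> 'M[R]_m) p :
  S^T = S -> smooth_entries M -> (forall q, M q *m S *m (M q)^T = S) ->
  along_mx X M p *m S *m (M p)^T = - (along_mx X M p *m S *m (M p)^T)^T.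
Proof.
move=> Ssym sM MS.
have sS : smooth_entries (fun _ : E => S) by move=> i j; exact: smooth_cst.
have sMT : smooth_entries (fun q => (M q)^T).
  by move=> i j; under eq_fun do rewrite mxE; exact: sM.
apply/eqP; rewrite -addr_eq0; apply/eqP.
have MSfun : (fun=> S) = (fun q => M q *m S *m (M q)^T).
  by apply/funext => q; rewrite MS.
rewrite -[RHS](along_mx_cst X S p) MSfun.
rewrite (along_mxM X p (smooth_entries_mul sM sS) sMT) along_mxM//.
rewrite along_mx_cst mulmx0 addr0 along_mxT.
by rewrite !trmx_mul trmxK Ssym mulmxA.
Qed.

End VectorFields.

Section Koszul.
Context {R : realType} {m : nat}.

(* The tensor e i j k = <row j (D i), row k J> is symmetric in i, j and
   antisymmetric in j, k. *)
Lemma koszul_eq0 (S J : 'M[R]_m) (D : 'I_m -> 'M[R]_m) :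
  S \in unitmx -> J \in unitmx -> (forall i j, row j (D i) = row i (D j)) ->
  (forall i, D i *m S *m J^T = - (D i *m S *m J^T)^T) ->
  forall i, D i = 0.
Proof.
move=> Su Ju Dsym Danti.
pose e i j k := (D i *m S *m J^T) j k.
have es i j k : e i j k = e j i k.
  have eE u v w : e u v w = (row v (D u) *m S *m J^T) 0 w.
    by rewrite -!row_mul [RHS]mxE.
  by rewrite !eE Dsym.
have ea i j k : e i j k = - e i k j by rewrite /e {1}Danti !mxE.
have e0 i j k : e i j k = 0.
  (* Six alternating swaps return to the same indices, and three of them change the sign. *)
  have : e i j k = - e i j k by rewrite {1}ea es ea opprK es ea es.
  lra.
move=> i; rewrite -[D i](mulmxK Su) -[D i *m S](@mulmxK _ _ _ J^T) ?unitmx_tr//.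
suff -> : D i *m S *m J^T = 0 by rewrite !mul0mx.
by apply/matrixP => j k; rewrite [LHS]e0 mxE.
Qed.

End Koszul.

Section Affine.
Context {R : realType} {n : nat}.
Local Notation E := 'rV[R]_n.+1.

(** The derivative of the Jacobian is symmetric by [partialC] and antisymmetric by
    [along_mx_isometry], so [koszul_eq0] makes the Jacobian constant. *)
Lemma pulls_back_cst_affine (S : 'M[R]_n.+1) (f : E -> E) :
  S^T = S -> S \in unitmx -> smooth f -> pulls_back f (fun=> S) (fun=> S) ->
  forall p, f p = f 0 + p *m jac f 0.
Proof.
move=> Ssym Su sf /(pulls_back_jac _ _ sf) pf.
have sfc j : smooth (fun q => f q 0 j) by exact: (smooth_rowP _).1.
have sJ : smooth_entries (jac f).
  by move=> i j; under eq_fun do rewrite mxE; exact: smooth_partial.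
have dJ0 p i : along_mx (fun=> delta_mx 0 i) (jac f) p = 0.
  apply: (@koszul_eq0 _ _ S (jac f p)
    (fun i => along_mx (fun=> delta_mx 0 i) (jac f) p)) => //.
  - by have := Su; rewrite -(pf p) !unitmx_mul => /andP[/andP[]].
  - move=> k l; apply/rowP => j; rewrite !mxE !along_partial.
    have jacE t : (fun q => jac f q t j) = partial t (fun q => f q 0 j).
      by apply/funext => q; rewrite mxE.
    by rewrite !jacE partialC.
  - by move=> k; exact: along_mx_isometry.
move=> p; apply/rowP => j.
pose b (q : E) := f 0 0 j + \sum_i q 0 i * jac f 0 i j.
have sterm i : smooth (fun q : E => q 0 i * jac f 0 i j).
  by apply: smoothM; [exact: smooth_coord|exact: smooth_cst].
have ssum : smooth (fun q : E => \sum_i q 0 i * jac f 0 i j).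
  exact: smooth_sum.
suff fb : (fun q => f q 0 j) = b.
  by rewrite -[LHS]/((fun q => f q 0 j) p) fb /b !mxE.
apply: eq_partial => //.
- by apply: smoothD => //; exact: smooth_cst.
- by rewrite /b big1 ?addr0// => i _; rewrite mxE mul0r.
move=> i q; rewrite partialD//; last exact: smooth_cst.
rewrite partial_cst add0r partial_sum// (bigD1 i)//= big1 ?addr0.
  rewrite partialM; [|exact: smooth_coord|exact: smooth_cst].
  rewrite partial_cst partial_coord eqxx mulr0 add0r mulr1 mxE.
  apply: partial_eq0_cst => [|k r]; first exact: smooth_partial.
  have /matrixP/(_ i j) := dJ0 r k; rewrite !mxE along_partial => <-.
  by congr (partial k _ r); apply/funext => t; rewrite mxE.
move=> k ki; rewrite partialM; [|exact: smooth_coord|exact: smooth_cst].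
by rewrite partial_cst partial_coord (negbTE ki) !mulr0 addr0.
Qed.

End Affine.

(** * The isometry group and its topology *)

Lemma continuous_pairing (T U V : topologicalType) (f : T -> U) (g : T -> V) :
  continuous f -> continuous g -> continuous (fun x => (f x, g x)).
Proof. by move=> cf cg x; exact: (cvg_pair (cf x) (cg x)). Qed.

Lemma continuous_comp2 (T U V : topologicalType) (f : T -> U) (g : U -> V) :
  continuous f -> continuous g -> continuous (g \o f).
Proof. by move=> cf cg x; apply: continuous_comp; [exact: cf|exact: cg]. Qed.

Lemma continuous_fst (T U : topologicalType) : continuous (@fst T U).
Proof. by move=> x; exact: cvg_fst. Qed.

Lemma continuous_snd (T U : topologicalType) : continuous (@snd T U).
Proof. by move=> x; exact: cvg_snd. Qed.

Section CompactOpen.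
Context {U V : topologicalType}.

Lemma eval_continuous (q : U) :
  continuous (fun f : {compact-open, U -> V} => f q).
Proof.
apply/continuousP => O oO.
have -> : (fun f : {compact-open, U -> V} => f q) @^-1` O =
    ([set f | f @` [set q] `<=` O] : set {compact-open, U -> V}).
  by apply/seteqP; split=> f /= fO; [move=> _ [_ -> <-]|apply: fO; exists q].
by apply: compact_open_open => //; exact: compact_set1.
Qed.

End CompactOpen.

Section ContinuousMatrix.
Context {R : realType} {T : topologicalType}.

Lemma continuous_addR (a b : T -> R) :
  continuous a -> continuous b -> continuous (fun x => a x + b x).
Proof.
by move=> ca cb x; exact: (@continuousD R R T a b x (ca x) (cb x)).
Qed.

Lemma continuous_subR (a b : T -> R) :
  continuous a -> continuous b -> continuous (fun x => a x - b x).
Proof.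
by move=> ca cb x; exact: (@continuousB R R T a b x (ca x) (cb x)).
Qed.

Lemma continuous_mulR (a b : T -> R) :
  continuous a -> continuous b -> continuous (fun x => a x * b x).
Proof.
by move=> ca cb x; exact: (@continuousM R T a b x (ca x) (cb x)).
Qed.

Lemma continuous_mxP m n (f : T -> 'M[R]_(m, n)) :
  (forall i j, continuous (fun x => f x i j)) -> continuous f.
Proof.
move=> cf x A [P nP PA].
have : \forall y \near x, forall i j, P i j (f y i j).
  by apply: filter_forall => i; apply: filter_forall => j; exact/cf/nP.
by apply: filterS => y /PA.
Qed.

Lemma continuous_entry m n (f : T -> 'M[R]_(m, n)) i j :
  continuous f -> continuous (fun x => f x i j).
Proof.
by move=> cf x; exact: (continuous_comp (cf x) (@coord_continuous R m n i j (f x))).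
Qed.

Lemma continuous_mulmx m n l (f : T -> 'M[R]_(m, n)) (g : T -> 'M[R]_(n, l)) :
  continuous f -> continuous g -> continuous (fun x => f x *m g x).
Proof.
move=> cf cg; apply: continuous_mxP => i j; under eq_fun do rewrite mxE.
apply: continuous_big; first exact: add_continuous.
by move=> k _; apply: continuous_mulR; exact: continuous_entry.
Qed.

End ContinuousMatrix.

Section HeisenbergGroup.
Context {R : realType}.
Local Notation H3 := 'rV[R]_3.
Local Notation x_ := (@Ordinal 3 0 isT).
Local Notation y_ := (@Ordinal 3 1 isT).
Local Notation z_ := (@Ordinal 3 2 isT).
Implicit Types (p q a : H3) (g : H3 -> 'M[R]_3).

Lemma rowH3P p q : p 0 x_ = q 0 x_ -> p 0 y_ = q 0 y_ -> p 0 z_ = q 0 z_ ->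
  p = q.
Proof. by move=> ex ey ez; apply/rowP; exact: ord3P. Qed.

Lemma mulH0 p : mulH p 0 = p.
Proof. by rewrite mulH_frame mul0mx addr0. Qed.

Lemma mulHA p q a : mulH p (mulH q a) = mulH (mulH p q) a.
Proof. by apply: rowH3P; rewrite !mxE /= /area !mxE /=; ring. Qed.

Lemma mulHK p : cancel (mulH p) (mulH (- p)).
Proof. by move=> q; apply: rowH3P; rewrite !mxE /= /area !mxE /=; ring. Qed.

Lemma mulHKV p : cancel (mulH (- p)) (mulH p).
Proof. by move=> q; rewrite -{1}(opprK p) mulHK. Qed.

Lemma smooth_mulmxr m n (A : 'M[R]_(m.+1, n.+1)) :
  smooth (fun q : 'rV[R]_m.+1 => q *m A).
Proof.
apply/smooth_rowP => j; under eq_fun do rewrite mxE.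
apply: smooth_sum => i; apply: smoothM; first exact: smooth_coord.
exact: smooth_cst.
Qed.

Lemma smooth_mulH a : smooth (mulH a).
Proof.
have -> : mulH a = fun q => a + q *m frame a.
  by apply/funext => q; rewrite mulH_frame.
by apply: smoothD; [exact: smooth_cst|exact: smooth_mulmxr].
Qed.

Lemma isometries_mulH g a : left_invariant g -> isometries g (mulH a).
Proof.
move=> gl; split; [exact: smooth_mulH|exact: gl|].
by exists (mulH (- a)); [exact: smooth_mulH|split; [exact: mulHK|exact: mulHKV]].
Qed.

Lemma continuous_mulH (T : topologicalType) (f h : T -> H3) :
  continuous f -> continuous h -> continuous (fun x => mulH (f x) (h x)).
Proof.
move=> cf ch; have c1 i : continuous (fun x => f x 0 i).
  exact: continuous_entry.
have c2 i : continuous (fun x => h x 0 i) by exact: continuous_entry.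
apply: continuous_mxP => i j; rewrite (ord1 i).
have -> : (fun x => mulH (f x) (h x) 0 j) =
    (fun x => f x 0 j + h x 0 j + 2^-1 * area (f x) (h x) * dz 0 j).
  by apply/funext => x; rewrite /mulH [LHS]mxE [X in X + _]mxE [X in _ + X]mxE.
apply: continuous_addR; first exact: continuous_addR.
apply: continuous_mulR; last exact: cst_continuous.
apply: continuous_mulR; first exact: cst_continuous.
by apply: continuous_subR; exact: continuous_mulR.
Qed.

(** The inverse of the product map is [f |-> (f 0, ext f)]: the translation part is the value at 0,
    because [Phi A] fixes 0. The product map is continuous into the compact-open topology because a
    jointly continuous map can be curried. *)
Lemma isometry_product_intro n g (K : set 'M[R]_n) (Phi : 'M[R]_n -> H3 -> H3)
    (ext : (H3 -> H3) -> 'M[R]_n) :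
  left_invariant g -> set_bij K (isotropy g) Phi ->
  (forall A B, K A -> K B -> Phi (A *m B) = Phi A \o Phi B) ->
  continuous (fun z : 'M[R]_n * H3 => Phi z.1 z.2) ->
  continuous (ext : {compact-open, H3 -> H3} -> 'M[R]_n) ->
  (forall a A, K A -> ext (mulH a \o Phi A) = A) ->
  isometry_product g K.
Proof.
move=> gl [Phiiso Phiinj Phisurj] PhiM cPhi cext extK; exists Phi.
split=> //.
- by move=> a; exact: isometries_mulH.
- by move=> A B; rewrite !inE; exact: PhiM.
have Phi0 A : K A -> Phi A 0 = 0 by move=> /Phiiso[].
have ffK aA : K aA.2 ->
    ((mulH aA.1 \o Phi aA.2) 0, ext (mulH aA.1 \o Phi aA.2)) = aA.
  by case: aA => a A /= KA; rewrite Phi0// mulH0 extK.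
split.
- split.
  + move=> [a A] [_ KA] /=; apply: isometries_comp; first exact: isometries_mulH.
    by case: (Phiiso A KA).
  + move=> aA bB; rewrite !inE => -[_ KA] [_ KB] E.
    by rewrite -(ffK aA KA) -(ffK bB KB) E.
  + move=> f fiso.
    (* The group inverse of [f 0] is [- f 0], so this translate of [f] fixes 0. *)
    have [|A KA fE] := Phisurj (mulH (- f 0) \o f).
      split; first by apply: isometries_comp => //; exact: isometries_mulH.
      by rewrite /= -{2}(mulH0 (f 0)) mulHK.
    exists (f 0, A) => //=; rewrite fE.
    by apply/funext => q /=; rewrite mulHKV.
- apply: continuous_subspaceT.
  have cF : continuous (fun z : (H3 * 'M[R]_n) * H3 =>
      mulH z.1.1 (Phi z.1.2 z.2)).
    have c1 := @continuous_fst (H3 * 'M[R]_n)%type H3.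
    have c2 := @continuous_snd (H3 * 'M[R]_n)%type H3.
    apply: continuous_mulH; first exact: continuous_comp2 c1 (@continuous_fst _ _).
    apply: (continuous_comp2 (f := fun z => (z.1.2, z.2))
      (g := fun w : 'M[R]_n * H3 => Phi w.1 w.2)) => //.
    apply: continuous_pairing => //.
    exact: continuous_comp2 c1 (@continuous_snd _ _).
  exact: (continuous_curry_fun cF).
- exists (fun f : {compact-open, H3 -> H3} => (f 0, ext f)).
    apply: continuous_subspaceT.
    by apply: continuous_pairing => //; exact: eval_continuous.
  by move=> aA; rewrite inE => -[_ KA]; exact: ffK.
Qed.

End HeisenbergGroup.

Ltac prove_smooth := repeat first
  [ exact: smooth_cst | exact: smooth_coord | done
  | apply: smoothB | apply: smoothD | apply: smoothM | apply: smoothN ].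

(** * Curvature of left-invariant metrics *)

Section LeftInvariantMetric.
Context {R : realType}.
Local Notation H3 := 'rV[R]_3.
Local Notation x_ := (@Ordinal 3 0 isT).
Local Notation y_ := (@Ordinal 3 1 isT).
Local Notation z_ := (@Ordinal 3 2 isT).
Implicit Types (p q a : H3) (g : H3 -> 'M[R]_3).

(* The left-invariant form dual to X3 is dz + \sum_i tau q i dx_i, and
   d(tau i) = \sum_k dtau i k dx_k. *)
Definition tau q (i : 'I_3) : R :=
  (q 0 y_ / 2) * (i == x_)%:R - (q 0 x_ / 2) * (i == y_)%:R.

Definition dtau (i k : 'I_3) : R :=
  2^-1 * ((i == x_)%:R * (k == y_)%:R - (i == y_)%:R * (k == x_)%:R).

Lemma tau0 i : tau 0 i = 0.
Proof. by rewrite /tau !mxE; ring. Qed.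

Lemma smooth_tau i : smooth (fun q => tau q i).
Proof. by rewrite /tau; prove_smooth. Qed.

Lemma partial_tau k i p : partial k (fun q => tau q i) p = dtau i k.
Proof.
rewrite /tau /dtau partialB; try by prove_smooth.
have pM c j : partial k (fun q : H3 => q 0 j / 2 * c) p = c / 2 * (j == k)%:R.
  rewrite (_ : (fun q : H3 => _) = (fun q => c / 2 * q 0 j)); last first.
    by apply/funext => q; ring.
  by rewrite partialZ ?partial_coord//; exact: smooth_coord.
rewrite !pM ![_ == k]eq_sym; ring.
Qed.

Lemma frameE q i j : frame q i j = (i == j)%:R - tau q i * (j == z_)%:R.
Proof.
move: i j; apply: ord3P; apply: ord3P; rewrite !mxE /= /tau ?mxE /=; ring.
Qed.

Lemma frameNE q i j : frame (- q) i j = (i == j)%:R + tau q i * (j == z_)%:R.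
Proof. by rewrite frameE /tau !mxE; ring. Qed.

Lemma mulmx3E m n (A : 'M[R]_(m, 3)) B (C : 'M[R]_(3, n)) i j :
  (A *m B *m C) i j =
  (A i x_ * B x_ x_ + A i y_ * B y_ x_ + A i z_ * B z_ x_) * C x_ j +
  (A i x_ * B x_ y_ + A i y_ * B y_ y_ + A i z_ * B z_ y_) * C y_ j +
  (A i x_ * B x_ z_ + A i y_ * B y_ z_ + A i z_ * B z_ z_) * C z_ j.
Proof. by rewrite mxE sum3 !mxE !sum3. Qed.

Lemma trmxE m n (A : 'M[R]_(m, n)) i j : A^T i j = A j i.
Proof. by rewrite mxE. Qed.

Lemma linv_metricE (G : 'M[R]_3) q i j : linv_metric G q i j =
  G i j + tau q i * G z_ j + G i z_ * tau q j + G z_ z_ * tau q i * tau q j.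
Proof.
rewrite /linv_metric invmx_frame mulmx3E !trmxE.
by move: i j; apply: ord3P; apply: ord3P; rewrite !frameNE /=; ring.
Qed.

Section Curvature.
Variables (G : 'M[R]_3).
Hypotheses (Gsym : G^T = G) (Gu : G \in unitmx).
Local Notation g := (linv_metric G).
Let Gi := invmx G.

Lemma smooth_linv_metric_entry i j : smooth (fun q => g q i j).
Proof.
under eq_fun do rewrite linv_metricE.
by prove_smooth; exact: smooth_tau.
Qed.

Lemma smooth_linv_metric : smooth g.
Proof. by apply/smooth_mxP => i j; exact: smooth_linv_metric_entry. Qed.

Lemma linv_metric_pseudo_riemannian : pseudo_riemannian g.
Proof.
split=> [|p]; first exact: smooth_linv_metric.
rewrite /linv_metric !trmx_mul trmxK Gsym mulmxA; split=> //.
by rewrite !unitmx_mul unitmx_tr unitmx_inv frame_unit Gu.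
Qed.

(** The components of the form dual to X_3 under the metric, that is, row [z_] of [g q]. *)
Definition theta q j := G z_ j + G z_ z_ * tau q j.

Lemma partial_linv_metric k i j p :
  partial k (fun q => g q i j) p = dtau i k * theta p j + dtau j k * theta p i.
Proof.
have -> : (fun q => g q i j) = (fun q => G i j + G z_ j * tau q i +
    G z_ i * tau q j + G z_ z_ * (tau q i * tau q j)).
  apply/funext => q; rewrite linv_metricE -[in G i z_]Gsym mxE; ring.
have st := smooth_tau.
rewrite partialD; [|by prove_smooth..].
rewrite partialD; [|by prove_smooth..].
rewrite partialD; [|by prove_smooth..].
rewrite partial_cst !partialZ; [|by prove_smooth..].
rewrite partialM; [|by prove_smooth..].
rewrite !partial_tau /theta; ring.
Qed.

Lemma invmx_linv_metric q :
  invmx (g q) = (frame q)^T *m Gi *m frame q.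
Proof.
apply: (can_inj (mulmxK (linv_metric_pseudo_riemannian.2 q).2)).
rewrite mulVmx ?(linv_metric_pseudo_riemannian.2 q).2//.
rewrite /linv_metric !mulmxA mulmxK ?frame_unit// mulmxKV//.
by rewrite -trmx_mul mulVmx ?trmx1// frame_unit.
Qed.

Definition dtau_up (k i : 'I_3) : R := \sum_l Gi k l * dtau l i.

(** [dtau] is antisymmetric, so in the sum of three metric derivatives the [theta q l] terms cancel
    and the others double, absorbing the factor 1/2. Raising the index with [invmx_linv_metric]
    changes only the component [k = z_], whence the correction by [tau]. *)
Lemma christoffel_linv k i j q : christoffel g k i j q =
  (dtau_up k i - (k == z_)%:R * \sum_a tau q a * dtau_up a i) * theta q j +
  (dtau_up k j - (k == z_)%:R * \sum_a tau q a * dtau_up a j) * theta q i.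
Proof.
rewrite /christoffel; under eq_bigr do rewrite !partial_linv_metric invmx_linv_metric.
rewrite /dtau_up !sum3 !mulmx3E !trmxE !frameE /dtau -/Gi.
by move: i j k; apply: ord3P; apply: ord3P; apply: ord3P; rewrite /=; field.
Qed.

(** By left invariance the curvature need only be computed at 0, where [tau] vanishes. *)
Lemma christoffel_linv0 k i j :
  christoffel g k i j 0 = dtau_up k i * G z_ j + dtau_up k j * G z_ i.
Proof.
rewrite christoffel_linv /theta !big1 => [|a _|a _]; rewrite ?tau0 ?mul0r//; ring.
Qed.

Lemma partial_christoffel_linv0 m k i j : partial m (christoffel g k i j) 0 =
  dtau_up k i * G z_ z_ * dtau j m + dtau_up k j * G z_ z_ * dtau i m -
  (k == z_)%:R * ((\sum_a dtau a m * dtau_up a i) * G z_ j +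
                  (\sum_a dtau a m * dtau_up a j) * G z_ i).
Proof.
pose S l q := \sum_a tau q a * dtau_up a l.
have sS l : smooth (S l).
  by apply: smooth_sum => a; apply: smoothM; [exact: smooth_tau|exact: smooth_cst].
have dS l p : partial m (S l) p = \sum_a dtau a m * dtau_up a l.
  rewrite /S partial_sum => [|a]; last first.
    by apply: smoothM; [exact: smooth_tau|exact: smooth_cst].
  apply: eq_bigr => a _; rewrite partialM; [|exact: smooth_tau|exact: smooth_cst].
  by rewrite partial_cst partial_tau; ring.
have stheta l : smooth (fun q => theta q l).
  by rewrite /theta; prove_smooth; exact: smooth_tau.
have dtheta l p : partial m (fun q => theta q l) p = G z_ z_ * dtau l m.
  rewrite /theta partialD; [|by prove_smooth; exact: smooth_tau..].
  by rewrite partial_cst partialZ ?partial_tau ?add0r//; exact: smooth_tau.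
have dcoef l p : partial m (fun q => dtau_up k l - (k == z_)%:R * S l q) p =
    - ((k == z_)%:R * \sum_a dtau a m * dtau_up a l).
  rewrite partialB; [|by prove_smooth; exact: sS..].
  by rewrite partial_cst partialZ ?dS ?sub0r//; exact: sS.
have scoef l : smooth (fun q => dtau_up k l - (k == z_)%:R * S l q).
  by prove_smooth; exact: sS.
have -> : christoffel g k i j = fun q =>
    (dtau_up k i - (k == z_)%:R * S i q) * theta q j +
    (dtau_up k j - (k == z_)%:R * S j q) * theta q i.
  by apply/funext => q; rewrite christoffel_linv.
rewrite partialD; [|exact: smoothM..].
rewrite !partialM// !dtheta !dcoef /theta !tau0.
have S0 l : S l 0 = 0 by rewrite /S big1// => a _; rewrite tau0 mul0r.
rewrite !S0; ring.
Qed.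

Lemma Gi_sym : Gi^T = Gi.
Proof. by rewrite /Gi trmx_inv Gsym. Qed.

(** The last factor is the minor of [invmx G] complementary to [G z_ z_], which equals
    [G z_ z_ / \det G]. *)
Lemma ricci_linv0_zz : ricci g 0 z_ z_ =
  2^-1 * G z_ z_ ^+ 2 * (Gi x_ x_ * Gi y_ y_ - Gi x_ y_ * Gi y_ x_).
Proof.
rewrite mxE sum3 /riemann !sum3 !christoffel_linv0 !partial_christoffel_linv0.
rewrite !sum3 /dtau_up !sum3 /dtau /= -/Gi.
have -> : Gi y_ x_ = Gi x_ y_ by rewrite -{1}Gi_sym mxE.
by field.
Qed.

Lemma flat_linv_metric_center_null : flat g -> G z_ z_ = 0.
Proof.
move=> fg; apply/eqP; apply: contraT => c0.
have : ricci g 0 z_ z_ = 0 by rewrite mxE big1// => i _; exact: fg.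
rewrite ricci_linv0_zz => /eqP; rewrite !mulf_eq0 invr_eq0 pnatr_eq0 (negbTE c0)/=.
move=> /eqP minor0.
have GiG i k : Gi i x_ * G x_ k + Gi i y_ * G y_ k + Gi i z_ * G z_ k = (i == k)%:R.
  by have /matrixP/(_ i k) := mulVmx Gu; rewrite !mxE sum3.
(* As the minor vanishes, this combination of the first two rows of [Gi] has only a [z_] entry;
   multiply it by [G]. Column [z_] kills that entry because [G z_ z_ != 0], so the coefficients
   vanish. In the end row [x_] of [Gi] is zero, which contradicts invertibility. *)
have e2 k : Gi y_ y_ * (x_ == k)%:R - Gi x_ y_ * (y_ == k)%:R =
    (Gi y_ y_ * Gi x_ z_ - Gi x_ y_ * Gi y_ z_) * G z_ k.
  rewrite -!GiG -[RHS]addr0 -(mul0r (G x_ k)) -minor0; ring.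
have e1 k : Gi x_ x_ * (y_ == k)%:R - Gi y_ x_ * (x_ == k)%:R =
    (Gi x_ x_ * Gi y_ z_ - Gi y_ x_ * Gi x_ z_) * G z_ k.
  rewrite -!GiG -[RHS]addr0 -(mul0r (G y_ k)) -minor0; ring.
have r0 (r t : R) : t = r * G z_ z_ -> t = 0 -> r = 0.
  by move=> -> /eqP; rewrite mulf_eq0 (negbTE c0) orbF => /eqP.
have r2 := r0 _ _ (e2 z_) ltac:(rewrite /=; ring).
have r1 := r0 _ _ (e1 z_) ltac:(rewrite /=; ring).
have xy0 : Gi x_ y_ = 0 by have := e2 y_; rewrite r2 /=; lra.
have xx0 : Gi x_ x_ = 0 by have := e1 y_; rewrite r1 /=; lra.
have xz0 : Gi x_ z_ = 0.
  by apply: (r0 _ _ _ erefl); have := GiG x_ z_; rewrite xx0 xy0 /=; lra.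
by have := GiG x_ x_; rewrite xx0 xy0 xz0 /=; lra.
Qed.

End Curvature.

Lemma linv_metric0 (G : 'M[R]_3) : linv_metric G 0 = G.
Proof. by rewrite /linv_metric invmx_frame oppr0 frame0 mul1mx trmx1 mulmx1. Qed.

End LeftInvariantMetric.

(** * Flat metrics *)

Section SignatureMatrix.
Context {R : realType}.

Lemma tr_sig_mx p q : (sig_mx p q : 'M[R]_(p + q))^T = sig_mx p q.
Proof. by rewrite /sig_mx tr_block_mx !trmx0 linearN/= !trmx1. Qed.

Lemma sig_mxK p q : sig_mx p q *m sig_mx p q = 1%:M :> 'M[R]_(p + q).
Proof.
rewrite /sig_mx mulmx_block !mulmx0 !mul0mx !addr0 !add0r mulmx1.
by rewrite mulmxN mulmx1 opprK -scalar_mx_block.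
Qed.

(** [S *m A^T *m S] is a right inverse of [A], hence also a left inverse. *)
Lemma orthogonal_tr n (S A : 'M[R]_n) :
  S *m S = 1%:M -> A *m S *m A^T = S -> A^T *m S *m A = S.
Proof.
move=> SS AS; have : A *m (S *m A^T *m S) = 1%:M by rewrite !mulmxA AS SS.
by move/mulmx1C => H; rewrite -[RHS]mulmx1 -H !mulmxA SS mul1mx.
Qed.

Lemma orthogonal_unit n (S A : 'M[R]_n) :
  S *m S = 1%:M -> A *m S *m A^T = S -> A \in unitmx.
Proof.
move=> SS AS; have : A *m (S *m A^T *m S) = 1%:M by rewrite !mulmxA AS SS.
by case/mulmx1_unit.
Qed.

End SignatureMatrix.

Section LinearMaps.
Context {R : realType}.

Lemma jac_mulmxr m n (A : 'M[R]_(m.+1, n.+1)) p : jac (fun q => q *m A) p = A.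
Proof.
apply/matrixP => i j; rewrite mxE.
have -> : (fun q : 'rV[R]_m.+1 => (q *m A) 0 j) = fun q => \sum_k A k j * q 0 k.
  by apply/funext => q; rewrite mxE; apply: eq_bigr => k _; rewrite mulrC.
rewrite partial_sum => [|k]; last first.
  by apply: smoothM; [exact: smooth_cst|exact: smooth_coord].
rewrite (bigD1 i)//= big1 => [|k ki]; rewrite partialZ; try exact: smooth_coord.
  by rewrite partial_coord eqxx mulr1 addr0.
by rewrite partial_coord (negbTE ki) mulr0.
Qed.

Lemma pulls_back_mulmxr n (A S1 S2 : 'M[R]_n.+1) : A *m S2 *m A^T = S1 ->
  pulls_back (fun q => q *m A) (fun=> S1) (fun=> S2).
Proof.
by move=> AS; apply/(pulls_back_jac _ _ (smooth_mulmxr A)) => p; rewrite jac_mulmxr.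
Qed.

End LinearMaps.

Section DevelopingMap.
Context {R : realType}.
Local Notation H3 := 'rV[R]_3.
Variables (g : H3 -> 'M[R]_3) (S : 'M[R]_3) (psi psii : H3 -> H3).
Hypotheses (gl : left_invariant g) (Ssym : S^T = S) (SS : S *m S = 1%:M).
Hypotheses (spsi : smooth psi) (spsii : smooth psii).
Hypotheses (psiK : cancel psi psii) (psiiK : cancel psii psi) (psi0 : psi 0 = 0).
Hypothesis (psiS : pulls_back psi g (fun=> S)).

(* Vectors are rows, so the transpose is needed for Phi to be a homomorphism. *)
Let Phi (A : 'M[R]_3) (q : H3) : H3 := psii (psi q *m A^T).

Let PhiM A B : Phi (A *m B) = Phi A \o Phi B.
Proof. by apply/funext => q /=; rewrite /Phi psiiK trmx_mul mulmxA. Qed.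

Let Phi1 : Phi 1%:M = id.
Proof. by apply/funext => q; rewrite /Phi trmx1 mulmx1 psiK. Qed.

Let smooth_Phi A : smooth (Phi A).
Proof.
apply: (smooth_comp (g := psii)) => //.
exact: (smooth_comp (smooth_mulmxr A^T) spsi).
Qed.

Let Phi0 A : Phi A 0 = 0.
Proof. by rewrite /Phi psi0 mul0mx -psi0 psiK. Qed.

Let isotropy_Phi A : orthogonal_group S A -> isotropy g (Phi A).
Proof.
move=> AS; have Au := orthogonal_unit SS AS; split; last exact: Phi0.
have cS : pulls_back (fun q => q *m A^T) (fun=> S) (fun=> S).
  by apply: pulls_back_mulmxr; rewrite trmxK; exact: orthogonal_tr.
have sA := smooth_mulmxr A^T.
have psiA := pulls_back_comp spsi sA psiS cS.
have sPA := smooth_comp sA spsi.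
split; first exact: smooth_Phi.
  exact: (pulls_back_comp sPA spsii psiA (pulls_back_inv spsi spsii psiiK psiS)).
exists (Phi (invmx A)); first exact: smooth_Phi.
by split=> q; rewrite -[LHS]/((_ \o _) q) -PhiM ?mulVmx ?mulmxV ?Phi1.
Qed.

(** After undoing the translation, conjugation by [psi] is linear on the isometries in question, so
    the images of the basis vectors are the rows of its matrix. *)
Let ext (f : H3 -> H3) : 'M[R]_3 :=
  (\matrix_i psi (mulH (- f 0) (f (psii (delta_mx 0 i)))))^T.

Let extK a A : ext (mulH a \o Phi A) = A.
Proof.
apply: trmx_inj; rewrite trmxK; apply/row_matrixP => i.
rewrite rowK /= Phi0 mulH0 mulHK /Phi !psiiK.
by rewrite -rowE.
Qed.

Let cont_ext : continuous (ext : {compact-open, H3 -> H3} -> 'M[R]_3).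
Proof.
apply: continuous_mxP => i j.
have -> : (fun f => ext f i j) = (fun f =>
    (psi (mulH (- f 0) (f (psii (delta_mx 0 j))))) 0 i).
  by apply/funext => f; rewrite !mxE.
apply: continuous_entry.
apply: (continuous_comp2 (g := psi)); last exact: smooth_continuous.
apply: continuous_mulH; last exact: eval_continuous.
move=> f; apply: (@continuousN R H3); exact: eval_continuous.
Qed.

Let cont_Phi : continuous (fun z : 'M[R]_3 * H3 => Phi z.1 z.2).
Proof.
apply: (continuous_comp2 (g := psii)); last exact: smooth_continuous.
apply: continuous_mulmx.
  apply: (continuous_comp2 (g := psi)); last exact: smooth_continuous.
  exact: continuous_snd.
apply: continuous_mxP => i j.
have -> : (fun z : 'M[R]_3 * H3 => (z.1^T) i j) = (fun z => z.1 j i).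
  by apply/funext => z; rewrite mxE.
by apply: continuous_entry; exact: continuous_fst.
Qed.

Lemma isometry_product_developing : isometry_product g (orthogonal_group S).
Proof.
apply: (isometry_product_intro gl (Phi := Phi) (ext := ext)) => //.
split=> //; first by move=> A B _ _ PAB; rewrite -(extK 0 A) -(extK 0 B) PAB.
move=> f [[sf pf _] f0].
(* Seen through [psi], [f] is an isometry of a constant metric that fixes 0, so it is linear. *)
pose F := psi \o (f \o psii).
have sF : smooth F by exact: smooth_comp spsi (smooth_comp sf spsii).
have FS : pulls_back F (fun=> S) (fun=> S).
  have p1 := pulls_back_inv spsi spsii psiiK psiS.
  exact: pulls_back_comp (smooth_comp sf spsii) spsi
    (pulls_back_comp spsii sf p1 pf) psiS.
have [Su _] := mulmx1_unit SS.
have FE q : F q = q *m jac F 0.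
  rewrite (pulls_back_cst_affine Ssym Su sF FS) /F /=.
  by rewrite -{1}psi0 psiK f0 psi0 add0r.
exists (jac F 0)^T.
  rewrite /orthogonal_group/= trmxK; apply: orthogonal_tr => //.
  exact: ((pulls_back_jac _ _ sF).1 FS 0).
by apply/funext => q; rewrite /Phi trmxK -FE /F /= !psiK.
Qed.

End DevelopingMap.

(** * Explicit integration of a metric with null center *)

Section FlatDeveloping.
Context {R : realType}.
Local Notation H3 := 'rV[R]_3.
Local Notation x_ := (@Ordinal 3 0 isT).
Local Notation y_ := (@Ordinal 3 1 isT).
Local Notation z_ := (@Ordinal 3 2 isT).
Variable G : 'M[R]_3.
Hypotheses (Gsym : G^T = G) (Gu : G \in unitmx) (Gzz : G z_ z_ = 0).

Let a := G x_ z_.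
Let b := G y_ z_.
Let C := G x_ x_ * b ^+ 2 - 2 * G x_ y_ * a * b + G y_ y_ * a ^+ 2.
Let n_ (i : 'I_3) : R := a * (i == y_)%:R - b * (i == x_)%:R.
Let u_ (i : 'I_3) : R := a * (i == x_)%:R + b * (i == y_)%:R.
Let v_ (i : 'I_3) : R := (a * G y_ i - b * G x_ i) / C.

(* u p = <p, X3> and v p = <p, n> / <n, n>, where n = a X2 - b X1 spans the
   complement of X3 in its orthogonal. *)
Let u (q : H3) : R := \sum_i u_ i * q 0 i.
Let v (q : H3) : R := \sum_i v_ i * q 0 i.

Let Gzx : G z_ x_ = a. Proof. by rewrite -Gsym mxE. Qed.
Let Gzy : G z_ y_ = b. Proof. by rewrite -Gsym mxE. Qed.
Let Gyx : G y_ x_ = G x_ y_. Proof. by rewrite -{1}Gsym mxE. Qed.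

(** [C] is [- \det G], since [G z_ z_ = 0]. The proof shows that [C = 0] would put nonzero vectors
    in the radical of [G]. *)
Let C_neq0 : C != 0.
Proof.
apply/eqP => C0.
have inj (w : H3) : w *m G = 0 -> w = 0.
  by move=> wG; rewrite -(mulmxK Gu w) wG mul0mx.
have wE (r s t : R) : r * G x_ x_ + s * G x_ y_ + t * a = 0 ->
    r * G x_ y_ + s * G y_ y_ + t * b = 0 -> r * a + s * b = 0 ->
    [/\ r = 0, s = 0 & t = 0].
  move=> e1 e2 e3.
  have w0 : \row_i nth 0 [:: r; s; t] i = 0 :> H3.
    apply: inj; apply/rowP; apply: ord3P; rewrite !mxE sum3 !mxE /=;
      by rewrite ?Gyx ?Gzx ?Gzy ?Gzz -/a -/b ?mulr0 ?addr0.
  move/rowP in w0.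
  by have := w0 x_; have := w0 y_; have := w0 z_; rewrite !mxE /=.
pose nx := a * G x_ y_ - b * G x_ x_; pose ny := a * G y_ y_ - b * G x_ y_.
have sq0 (r : R) : r * r = 0 -> r = 0 by move/eqP; rewrite mulf_eq0 orbb => /eqP.
(* The vector [a n - <n, X1> X3] is orthogonal to X1 and X3, and its product with X2 is [C].
   Likewise [b n - <n, X2> X3] below; once [a = b = 0], X3 itself lies in the radical. *)
have [|||_ /sq0 a0 _] := wE (- b * a) (a * a) (- nx).
- by rewrite /nx; ring.
- by rewrite -[RHS]C0 /C /nx; ring.
- ring.
have [|||/eqP + _ _] := wE (- (b * b)) (a * b) (- ny).
- by rewrite -[RHS]oppr0 -[in RHS]C0 /C /ny; ring.
- by rewrite /ny; ring.
- ring.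
rewrite oppr_eq0 => /eqP/sq0 b0.
have [|||_ _] := wE 0 0 1; try by rewrite ?a0 ?b0; ring.
by move=> /eqP; rewrite oner_eq0.
Qed.

(* In the coordinates u, v, z the metric is C dv^2 + 2 du dz + v du^2 - u du dv,
   up to a linear change of z; the substitution w = v - u^2 / (2 C),
   s = z + u v / 2 - u^3 / (6 C) turns it into C dw^2 + 2 du ds. *)
Definition dev (q : H3) (j : 'I_3) : R := q 0 j - u q ^+ 2 / (2 * C) * n_ j +
  (u q * v q / 2 - u q ^+ 3 / (6 * C)) * (j == z_)%:R.

(** Here [v q] is the coordinate w; substituting v = w + u^2 / (2 C) in the formula for s gives the
    coefficient 1/12 = 1/4 - 1/6. *)
Definition undev (q : H3) (j : 'I_3) : R := q 0 j + u q ^+ 2 / (2 * C) * n_ j -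
  (u q * v q / 2 + u q ^+ 3 / (12 * C)) * (j == z_)%:R.

Let smooth_lin3 (c : 'I_3 -> R) : smooth (fun q : H3 => \sum_i c i * q 0 i).
Proof.
by apply: smooth_sum => i; apply: smoothM; [exact: smooth_cst|exact: smooth_coord].
Qed.

Let partial_lin3 (c : 'I_3 -> R) i p :
  partial i (fun q : H3 => \sum_i c i * q 0 i) p = c i.
Proof.
rewrite partial_sum => [|k]; last first.
  by apply: smoothM; [exact: smooth_cst|exact: smooth_coord].
rewrite (bigD1 i)//= big1 => [|k ki]; rewrite partialZ; try exact: smooth_coord.
  by rewrite partial_coord eqxx mulr1 addr0.
by rewrite partial_coord (negbTE ki) mulr0.
Qed.

Let su : smooth u. Proof. exact: smooth_lin3. Qed.
Let sv : smooth v. Proof. exact: smooth_lin3. Qed.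
Let du i p : partial i u p = u_ i. Proof. exact: partial_lin3. Qed.
Let dv i p : partial i v p = v_ i. Proof. exact: partial_lin3. Qed.

Let devE j : (fun q => dev q j) = fun q : H3 => q 0 j
  - (n_ j / (2 * C)) * (u q * u q) + ((j == z_)%:R / 2) * (u q * v q)
  - ((j == z_)%:R / (6 * C)) * (u q * (u q * u q)).
Proof. by apply/funext => q; rewrite /dev; field. Qed.

Let smooth_dev j : smooth (fun q => dev q j).
Proof. by rewrite devE; prove_smooth. Qed.

Let smooth_undev j : smooth (fun q => undev q j).
Proof.
have -> : (fun q => undev q j) = fun q : H3 => q 0 j
  + (n_ j / (2 * C)) * (u q * u q) - ((j == z_)%:R / 2) * (u q * v q)
  - ((j == z_)%:R / (12 * C)) * (u q * (u q * u q)).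
  by apply/funext => q; rewrite /undev; field.
by prove_smooth.
Qed.

Let partial_dev i j p : partial i (fun q => dev q j) p = (i == j)%:R
  - u p * u_ i / C * n_ j
  + ((u_ i * v p + u p * v_ i) / 2 - u p ^+ 2 * u_ i / (2 * C)) * (j == z_)%:R.
Proof.
rewrite devE partialB; [|by prove_smooth..].
rewrite partialD; [|by prove_smooth..].
rewrite partialB; [|by prove_smooth..].
rewrite !partialZ; [|by prove_smooth..].
rewrite !partialM; [|by prove_smooth..].
by rewrite partial_coord [j == i]eq_sym !du !dv; field.
Qed.

Let phi (q : H3) : H3 := \row_j dev q j.
Let phii (q : H3) : H3 := \row_j undev q j.

Let u_n : \sum_i u_ i * n_ i = 0.
Proof. by rewrite sum3 /u_ /n_ /=; ring. Qed.

Let CvE i : C * v_ i = a * G y_ i - b * G x_ i.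
Proof. by rewrite /v_ mulrC divfK. Qed.

Let v_n : \sum_i v_ i * n_ i = 1.
Proof.
apply: (mulfI C_neq0); transitivity (a * (C * v_ y_) - b * (C * v_ x_)).
  by rewrite sum3 /n_ /=; ring.
by rewrite !CvE Gyx mulr1 /C; ring.
Qed.

Let v_z : v_ z_ = 0.
Proof. by rewrite /v_ -/a -/b [a * b]mulrC subrr mul0r. Qed.

Let u_z : u_ z_ = 0.
Proof. by rewrite /u_ !mulr0 addr0. Qed.

(** [dev] and [undev] move a point only along n and X3. Such a move leaves [u] fixed and shifts [v]
    by the n-component alone, so the substitution is triangular and its inverse polynomial. *)
Let lin_shift (c : 'I_3 -> R) (q p : H3) r s :
  (forall j, p 0 j = q 0 j + r * n_ j + s * (j == z_)%:R) ->
  \sum_i c i * p 0 i = \sum_i c i * q 0 i + r * (\sum_i c i * n_ i) + s * c z_.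
Proof. by move=> pE; rewrite !sum3 !pE /=; ring. Qed.

Let u_shift (q p : H3) r s :
  (forall j, p 0 j = q 0 j + r * n_ j + s * (j == z_)%:R) -> u p = u q.
Proof. by move=> /lin_shift E; rewrite /u E u_n u_z !mulr0 !addr0. Qed.

Let v_shift (q p : H3) r s :
  (forall j, p 0 j = q 0 j + r * n_ j + s * (j == z_)%:R) -> v p = v q + r.
Proof. by move=> /lin_shift E; rewrite /v E v_n v_z mulr0 addr0 mulr1. Qed.

Let phiK : cancel phi phii.
Proof.
move=> q; have H j : phi q 0 j = q 0 j + (- (u q ^+ 2 / (2 * C))) * n_ j +
    (u q * v q / 2 - u q ^+ 3 / (6 * C)) * (j == z_)%:R.
  by rewrite mxE /dev mulNr.
apply/rowP => j; rewrite mxE /undev (u_shift H) (v_shift H) H.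
by field.
Qed.

Let phiiK : cancel phii phi.
Proof.
move=> q; have H j : phii q 0 j = q 0 j + u q ^+ 2 / (2 * C) * n_ j +
    (- (u q * v q / 2 + u q ^+ 3 / (12 * C))) * (j == z_)%:R.
  by rewrite mxE /undev mulNr.
apply/rowP => j; rewrite mxE /dev (u_shift H) (v_shift H) H.
by field.
Qed.

(** The pair ([u], [v]) has determinant 1 with respect to (x, y), and [tau] is unchanged under
    unimodular changes of the plane. *)
Let tauE q i : tau q i = (u_ i * v q - u q * v_ i) / 2.
Proof.
have uv : u_ x_ * v_ y_ - u_ y_ * v_ x_ = 1.
  by rewrite -v_n sum3 /u_ /n_ /=; ring.
rewrite /u /v !sum3 u_z v_z.
move: i; apply: ord3P.
- transitivity (q 0 y_ / 2 * (u_ x_ * v_ y_ - u_ y_ * v_ x_)); last by field.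
  by rewrite uv /tau /=; ring.
- transitivity (- (q 0 x_ / 2) * (u_ x_ * v_ y_ - u_ y_ * v_ x_)); last by field.
  by rewrite uv /tau /=; ring.
- by rewrite u_z v_z /tau /=; ring.
Qed.

Let GzE i : G i z_ = u_ i.
Proof. by move: i; apply: ord3P; rewrite /u_ /= ?Gzz -/a -/b; ring. Qed.

(** Bilinear expansion with [<n, n> = C], [<n, X3> = <X3, X3> = 0], [<e_i, n> = C v_i] and
    [<e_i, X3> = u_i]. *)
Let bilinear_shift (i j : 'I_3) (r s t w : R) :
  \sum_k \sum_l ((i == k)%:R + r * n_ k + s * (k == z_)%:R) * G k l *
    ((j == l)%:R + t * n_ l + w * (l == z_)%:R) =
  G i j + t * (C * v_ i) + w * u_ i + r * (C * v_ j) + s * u_ j + r * t * C.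
Proof.
rewrite !CvE -!GzE !sum3 /n_ /C -/a -/b Gzx Gzy Gzz.
by move: i j; apply: ord3P; apply: ord3P; rewrite /= -/a -/b ?Gyx ?Gzx ?Gzy ?Gzz; ring.
Qed.

Let phi_metric p : jac phi p *m G *m (jac phi p)^T = linv_metric G p.
Proof.
have jacE : jac phi p = \matrix_(i, j) ((i == j)%:R
  - u p * u_ i / C * n_ j
  + ((u_ i * v p + u p * v_ i) / 2 - u p ^+ 2 * u_ i / (2 * C)) * (j == z_)%:R).
  apply/matrixP => i j; rewrite !mxE -partial_dev; congr (partial i _ p).
  by apply/funext => q; rewrite mxE.
apply/matrixP => i j; rewrite linv_metricE jacE mulmx3E !trmxE.
pose J i k := (i == k)%:R + (- (u p * u_ i / C)) * n_ k +
  ((u_ i * v p + u p * v_ i) / 2 - u p ^+ 2 * u_ i / (2 * C)) * (k == z_)%:R.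
transitivity (\sum_k \sum_l J i k * G k l * J j l).
  by rewrite !sum3 !mxE /J; ring.
rewrite bilinear_shift GzE -[G z_ j]trmxE Gsym GzE Gzz !tauE.
by field.
Qed.

Lemma flat_linv_metric_developing (P S : 'M[R]_3) :
  P \in unitmx -> G = P *m S *m P^T ->
  exists psi psii : H3 -> H3, [/\ smooth psi, smooth psii,
    cancel psi psii /\ cancel psii psi, psi 0 = 0 &
    pulls_back psi (linv_metric G) (fun=> S)].
Proof.
move=> Pu GE; exists (fun q => phi q *m P), (fun q => phii (q *m invmx P)).
have sphi : smooth phi.
  apply/smooth_rowP => j; under eq_fun do rewrite mxE; exact: smooth_dev.
have sphii : smooth phii.
  apply/smooth_rowP => j; under eq_fun do rewrite mxE; exact: smooth_undev.
split.
- exact: (smooth_comp (smooth_mulmxr P) sphi).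
- exact: (smooth_comp sphii (smooth_mulmxr (invmx P))).
- by split=> q; rewrite ?mulmxK ?phiK// phiiK mulmxKV.
- suff -> : phi 0 = 0 by rewrite mul0mx.
  have u0 : u 0 = 0 by rewrite /u big1// => i _; rewrite mxE mulr0.
  by apply/rowP => j; rewrite !mxE /dev u0 mxE; ring.
have pG : pulls_back phi (linv_metric G) (fun=> G).
  by apply/(pulls_back_jac _ _ sphi); exact: phi_metric.
exact: (pulls_back_comp sphi (smooth_mulmxr P) pG (pulls_back_mulmxr (esym GE))).
Qed.

End FlatDeveloping.

(** * Metrics with a nondegenerate center *)

Section LeftInvariantFrame.
Context {R : realType}.
Local Notation H3 := 'rV[R]_3.
Local Notation x_ := (@Ordinal 3 0 isT).
Local Notation y_ := (@Ordinal 3 1 isT).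
Local Notation z_ := (@Ordinal 3 2 isT).
Implicit Types (p q : H3) (h : H3 -> R).

Definition frame_field (i : 'I_3) q : H3 := row i (frame q).

Local Notation X := frame_field.
Local Notation D i := (along (X i)).

Lemma frame_fieldE i q k : X i q 0 k = (i == k)%:R - tau q i * (k == z_)%:R.
Proof. by rewrite mxE frameE. Qed.

Lemma smooth_frame_field i : smooth (X i).
Proof.
apply/smooth_rowP => k; under eq_fun do rewrite frame_fieldE.
by prove_smooth; exact: smooth_tau.
Qed.

Lemma smooth_along_frame i h : smooth h -> smooth (D i h).
Proof. exact: smooth_along (smooth_frame_field i). Qed.

Lemma along_frameE i h p : D i h p = partial i h p - tau p i * partial z_ h p.
Proof.
rewrite /along sum3 !frame_fieldE /=; move: i; apply: ord3P => /=;
  move: (partial x_ h p) (partial y_ h p) (partial z_ h p) => dx dy dz; ring.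
Qed.

Lemma partial_along_frame i h p :
  partial i h p = D i h p + tau p i * D z_ h p.
Proof.
rewrite !along_frameE {3}/tau /=.
by move: (partial i h p) (partial z_ h p) => di dz; ring.
Qed.

(** The relation [[X_1, X_2] = X_3], with [2 * dtau i j] as structure constants. *)
Lemma along_frame_commutator i j h p : smooth h ->
  D i (D j h) p - D j (D i h) p = 2 * dtau i j * D z_ h p.
Proof.
move=> sh; rewrite along_commutator//; try exact: smooth_frame_field.
have DX a b k : D a (fun q => X b q 0 k) p = - (dtau b a * (k == z_)%:R).
  have -> : (fun q => X b q 0 k) = (fun q => (b == k)%:R - (k == z_)%:R * tau q b).
    by apply/funext => q; rewrite frame_fieldE mulrC.
  have st := smooth_tau (R := R) b.
  rewrite along_frameE !partialB; [|by prove_smooth..].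
  rewrite !partial_cst !partialZ// !partial_tau.
  by rewrite {2}/dtau /=; ring.
rewrite sum3 !DX along_frameE /tau /= /dtau.
by move: (partial x_ h p) (partial y_ h p) (partial z_ h p) => dx dy dz; ring.
Qed.

Lemma along_frame_eq0_cst h p :
  smooth h -> (forall i q, D i h q = 0) -> h p = h 0.
Proof.
move=> sh Dh; apply: partial_eq0_cst => // i q.
by rewrite partial_along_frame !Dh mulr0 addr0.
Qed.

End LeftInvariantFrame.

Local Opaque along frame.

(** * The differential of a map in the left-invariant frame *)

Section FrameJacobian.
Context {R : realType}.
Local Notation H3 := 'rV[R]_3.
Local Notation x_ := (@Ordinal 3 0 isT).
Local Notation y_ := (@Ordinal 3 1 isT).
Local Notation z_ := (@Ordinal 3 2 isT).
Local Notation D i := (along (frame_field i)).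
Variables (f : H3 -> H3) (sf : smooth f).

Definition frame_jac p : 'M[R]_3 := frame p *m jac f p *m frame (- f p).

Local Notation M := frame_jac.
Let fc (j : 'I_3) q : R := f q 0 j.
Let sfc j : smooth (fc j). Proof. exact: (smooth_rowP _).1. Qed.

(** Column [j] is the pull-back by [f] of the j-th form of the dual frame, evaluated on X_i; the
    correction for [j = z_] comes from the third form dz + (y dx - x dy) / 2. *)
Lemma frame_jacE i j p : M p i j = D i (fc j) p +
  (j == z_)%:R * 2^-1 * (fc y_ p * D i (fc x_) p - fc x_ p * D i (fc y_) p).
Proof.
rewrite /frame_jac.
rewrite mulmx3E.
rewrite (frameNE (f p) x_) (frameNE (f p) y_) (frameNE (f p) z_).
have DE k : \sum_l frame p i l * jac f p l k = D i (fc k) p.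
  by apply: eq_bigr => l _; rewrite !mxE.
have {}DE k : frame p i x_ * jac f p x_ k + frame p i y_ * jac f p y_ k +
    frame p i z_ * jac f p z_ k = D i (fc k) p by rewrite -DE sum3.
rewrite !DE /tau -/(fc x_ p) -/(fc y_ p).
move: (fc x_ p) (fc y_ p) => u v; move: j; apply: ord3P => /=;
  move: (D i (fc x_) p) (D i (fc y_) p) (D i (fc z_) p) => dx dy dz; by field.
Qed.

Lemma frame_jac0 : f 0 = 0 -> M 0 = jac f 0.
Proof.
by move=> f0; rewrite /frame_jac f0 oppr0 frame0 mul1mx mulmx1.
Qed.

Lemma smooth_frame_jac : smooth_entries M.
Proof.
move=> i j; have -> : (fun q => M q i j) = fun q => D i (fc j) q +
   (j == z_)%:R * 2^-1 * (fc y_ q * D i (fc x_) q - fc x_ q * D i (fc y_) q).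
  by apply/funext => q; rewrite frame_jacE.
have sD a l : smooth (D a (fc l)) by exact: smooth_along_frame.
by prove_smooth.
Qed.

(* Structure equations: the pull-back by f commutes with d. *)
Lemma frame_jac_torsion i j k p :
  D i (fun q => M q j k) p - D j (fun q => M q i k) p =
  2 * dtau i j * M p z_ k -
  (k == z_)%:R * (M p i x_ * M p j y_ - M p i y_ * M p j x_).
Proof.
have ME a : (fun q => M q a k) = fun q => D a (fc k) q +
   (k == z_)%:R * 2^-1 * (fc y_ q * D a (fc x_) q - fc x_ q * D a (fc y_) q).
  by apply/funext => q; rewrite frame_jacE.
have sD a l : smooth (D a (fc l)) by exact: smooth_along_frame.
have DM a b : D a (fun q => M q b k) p = D a (D b (fc k)) p +
   (k == z_)%:R * 2^-1 * (D a (fc y_) p * D b (fc x_) p + fc y_ p * D a (D b (fc x_)) p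
    - (D a (fc x_) p * D b (fc y_) p + fc x_ p * D a (D b (fc y_)) p)).
  rewrite ME alongD; [|by prove_smooth..].
  congr (_ + _); rewrite alongM; [|by prove_smooth..].
  rewrite along_cst mul0r add0r; congr (_ * _).
  have -> : (fun q => fc y_ q * D b (fc x_) q - fc x_ q * D b (fc y_) q) =
     (fun q => fc y_ q * D b (fc x_) q + (-1) * (fc x_ q * D b (fc y_) q)).
    by apply/funext => q; ring.
  rewrite alongD; [|by prove_smooth..].
  rewrite !alongM; [|by prove_smooth..].
  rewrite along_cst; move: (fc x_ p) (fc y_ p) => u v.
  move: (D a (fc x_) p) (D a (fc y_) p) (D b (fc x_) p) (D b (fc y_) p).
  by move: (D a (D b (fc x_)) p) (D a (D b (fc y_)) p) => *; ring.
have C l : D i (D j (fc l)) p = D j (D i (fc l)) p + 2 * dtau i j * D z_ (fc l) p.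
  by rewrite -along_frame_commutator// addrC subrK.
rewrite !DM !C !frame_jacE /=.
move: (fc x_ p) (fc y_ p) => u v.
move: (D j (D i (fc k)) p) (D j (D i (fc x_)) p) (D j (D i (fc y_)) p) => d1 d2 d3.
move: (D z_ (fc k) p) (D z_ (fc x_) p) (D z_ (fc y_) p) => e1 e2 e3.
move: (D i (fc x_) p) (D i (fc y_) p) (D j (fc x_) p) (D j (fc y_) p) => *.
by field.
Qed.

End FrameJacobian.

(** * Curvature and rigidity when X_3 is orthogonal to X_1 and X_2 *)

Section NondegenerateCenter.
Context {R : realType}.
Local Notation H3 := 'rV[R]_3.
Local Notation x_ := (@Ordinal 3 0 isT).
Local Notation y_ := (@Ordinal 3 1 isT).
Local Notation z_ := (@Ordinal 3 2 isT).
Local Notation D i := (along (frame_field i)).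
(** The hypotheses hold for [h1] with [c = - 1] and for [h2] with [c = 1]. *)
Variable G : 'M[R]_3.
Hypotheses (Gsym : G^T = G) (GG : G *m G = 1%:M).
Hypotheses (Gxz : G x_ z_ = 0) (Gyz : G y_ z_ = 0).
Hypothesis Gdet : G z_ z_ * (G x_ x_ * G y_ y_ - G x_ y_ ^+ 2) = - 1.

Local Notation c := (G z_ z_).

Let Gu : G \in unitmx. Proof. by case/mulmx1_unit: GG. Qed.
Let Gyx : G y_ x_ = G x_ y_. Proof. by rewrite -{1}Gsym mxE. Qed.
Let Gzx : G z_ x_ = 0. Proof. by rewrite -Gsym mxE. Qed.
Let Gzy : G z_ y_ = 0. Proof. by rewrite -Gsym mxE. Qed.

Let GGE i j : G i x_ * G x_ j + G i y_ * G y_ j + G i z_ * G z_ j = (i == j)%:R.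
Proof. by have /matrixP/(_ i j) := GG; rewrite !mxE sum3. Qed.

Let cc : c * c = 1.
Proof. by have := GGE z_ z_; rewrite /= Gzx Gzy !mul0r !add0r. Qed.

(** The plane block of [G] is its own inverse and has determinant [- c]; this and the next two facts
    compare it with its adjugate. *)
Let cyy : c * G y_ y_ = - G x_ x_.
Proof.
have := (GGE x_ x_, GGE x_ y_); rewrite /= Gyx Gzx Gzy Gxz => -[xx xy].
have -> : - G x_ x_ = G x_ x_ * (c * (G x_ x_ * G y_ y_ - G x_ y_ ^+ 2)).
  by rewrite Gdet; ring.
have -> : G x_ x_ * (c * (G x_ x_ * G y_ y_ - G x_ y_ ^+ 2)) =
  c * (G y_ y_ * (G x_ x_ * G x_ x_ + G x_ y_ * G x_ y_ + 0 * 0)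
    - G x_ y_ * (G x_ x_ * G x_ y_ + G x_ y_ * G y_ y_ + 0 * 0)) by ring.
by rewrite xx xy; ring.
Qed.

Let cxy : c * G x_ y_ = G x_ y_.
Proof.
have := (GGE y_ y_, GGE x_ y_); rewrite /= Gyx Gzy Gxz Gyz => -[yy xy].
rewrite [RHS](_ : _ = - G x_ y_ * (c * (G x_ x_ * G y_ y_ - G x_ y_ ^+ 2))); last first.
  by rewrite Gdet; ring.
have -> : - G x_ y_ * (c * (G x_ x_ * G y_ y_ - G x_ y_ ^+ 2)) =
  c * (G x_ y_ * (G x_ y_ * G x_ y_ + G y_ y_ * G y_ y_ + 0 * 0)
    - G y_ y_ * (G x_ x_ * G x_ y_ + G x_ y_ * G y_ y_ + 0 * 0)) by ring.
by rewrite yy xy; ring.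
Qed.

Let cxx : c * G x_ x_ = - G y_ y_.
Proof. by rewrite -[G x_ x_]opprK -cyy mulrN mulrA cc mul1r. Qed.

Let GV : invmx G = G.
Proof. by rewrite -[RHS]mul1mx -(mulVmx Gu) -mulmxA GG mulmx1. Qed.

Lemma soliton_linv : algebraic_ricci_soliton (linv_metric G).
Proof.
split; [exact: linv_metric_pseudo_riemannian|exact: linv_metric_left_invariant|].
(* The Ricci operator is diag(1/2, 1/2, -1/2), and diag(d, d, 2 d) is a derivation; c + d = 1/2 and
   c + 2 d = -1/2 give d = -1 and c = 3/2. *)
exists (3 / 2), (diag_mx (\row_j (if j == z_ then -2 else -1))).
  move=> u v; apply/rowP => j; rewrite /bracket -scalemxAl !mul_mx_diag !mxE.
  by move: j; apply: ord3P; rewrite /area !mxE /=; ring.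
rewrite /ricci_op linv_metric0 GV.
have ricE : ricci (linv_metric G) 0 =
    diag_mx (\row_j (if j == z_ then - 2^-1 else 2^-1)) *m G.
  apply/matrixP => j k; rewrite mul_diag_mx !mxE sum3 /riemann !sum3.
  rewrite !(christoffel_linv0 Gsym Gu) !(partial_christoffel_linv0 Gsym Gu).
  rewrite !sum3 /dtau_up !sum3 GV /dtau.
  have [[hxx hxy] hyy] := (cxx, cxy, cyy).
  have hcc : c ^+ 2 * (G x_ x_ * G y_ y_ - G x_ y_ ^+ 2) = - c.
    by rewrite expr2 -mulrA Gdet; ring.
  move: j k; apply: ord3P; apply: ord3P;
    rewrite /= ?Gxz ?Gyz ?Gyx ?Gzx ?Gzy; lra.
rewrite ricE -mulmxA GG mulmx1; apply/matrixP => j k.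
by move: j k; apply: ord3P; apply: ord3P; rewrite !mxE /=; field.
Qed.

(* The Levi-Civita connection in the left-invariant frame: row j of B i holds
   the components of nabla_(X_i) X_j. *)
Let B (i : 'I_3) : 'M[R]_3 := \matrix_(j, k) (dtau i j * (k == z_)%:R +
  dtau_up G k i * G z_ j + dtau_up G k j * G z_ i).

Let dtauN i j : dtau i j = - dtau j i :> R.
Proof. by rewrite /dtau; ring. Qed.

(** The connection is torsion-free. *)
Let B_sym i j k : B i j k - B j i k = 2 * dtau i j * (k == z_)%:R.
Proof. by rewrite !mxE [dtau j i]dtauN; ring. Qed.

(** The connection is metric: lowering the index undoes [dtau_up], and what is left is antisymmetric
    by [dtauN]. *)
Let B_anti i : B i *m G = - (B i *m G)^T.
Proof.
have uuG i' l : \sum_k dtau_up G k i' * G k l = dtau l i'.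
  rewrite /dtau_up; under eq_bigr do rewrite mulr_suml.
  rewrite exchange_big/= (bigD1 l)//= [X in _ + X]big1 ?addr0 => [|m ml].
    transitivity ((G *m invmx G) l l * dtau l i').
      by rewrite mxE mulr_suml; apply: eq_bigr => k _; rewrite -{2}Gsym mxE; ring.
    by rewrite mulmxV// mxE eqxx mul1r.
  transitivity ((G *m invmx G) l m * dtau m i').
    by rewrite mxE mulr_suml; apply: eq_bigr => k _; rewrite -{2}Gsym mxE; ring.
  by rewrite mulmxV// mxE eq_sym (negbTE ml) mul0r.
have BGE j l : (B i *m G) j l =
    dtau i j * G z_ l + dtau l i * G z_ j + dtau l j * G z_ i.
  rewrite mxE; transitivity (\sum_k (dtau i j * ((k == z_)%:R * G k l) +
      dtau_up G k i * G k l * G z_ j + dtau_up G k j * G k l * G z_ i)).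
    by apply: eq_bigr => k _; rewrite !mxE; ring.
  by rewrite !big_split/= -!mulr_suml -mulr_sumr !uuG sum3 /=; ring.
apply/matrixP => j l; rewrite [RHS]mxE [(_^T) _ _]mxE !BGE.
rewrite [dtau i l]dtauN [dtau j i]dtauN [dtau j l]dtauN; ring.
Qed.

(* K i l is the matrix of R(X_l, X_i); in dimension 3 it splits into a part W
   of constant curvature type and a part carried by the plane of X_1, X_2. *)
Let K i l : 'M[R]_3 := B i *m B l - B l *m B i - (2 * dtau l i) *: B z_.

Let W i l : 'M[R]_3 :=
  \matrix_(u, v) (G u i * (l == v)%:R - G u l * (i == v)%:R).

Let KE i l : K i l = (- 4^-1) *: W i l + (2 * dtau i l) *: W x_ y_.
Proof.
have cE : c = G x_ y_ ^+ 2 - G x_ x_ * G y_ y_.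
  transitivity (- (c * (c * (G x_ x_ * G y_ y_ - G x_ y_ ^+ 2)))).
    by rewrite Gdet; ring.
  by rewrite mulrA cc; ring.
(* The values of [dtau_up * c] with [c] absorbed by [cxx], [cxy] and [cyy], so that [B] becomes
   linear in the entries of the plane block. *)
pose cu (k i : 'I_3) : R := 2^-1 * (
  (i == x_)%:R * ((k == y_)%:R * G x_ x_ - (k == x_)%:R * G x_ y_) +
  (i == y_)%:R * ((k == y_)%:R * G x_ y_ - (k == x_)%:R * G y_ y_)).
have cuE k a : dtau_up G k a * c = cu k a.
  have -> : dtau_up G k a = \sum_m G k m * dtau m a by rewrite /dtau_up GV.
  have := (cxx, cxy, cyy) => -[[hxx hxy] hyy].
  rewrite sum3; move: k a; apply: ord3P; apply: ord3P;
    rewrite /dtau /cu /= ?Gyx ?Gzx ?Gzy ?Gxz ?Gyz; lra.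
have BE a j k : B a j k = dtau a j * (k == z_)%:R + cu k a * (j == z_)%:R
    + cu k j * (a == z_)%:R.
  have GzE m : G z_ m = c * (m == z_)%:R.
    by move: m; apply: ord3P; rewrite ?Gzx ?Gzy /=; ring.
  by rewrite mxE (GzE j) (GzE a) !mulrA !cuE.
have addE u v (A C : 'M[R]_3) : (A + C) u v = A u v + C u v by rewrite mxE.
have oppE u v (A : 'M[R]_3) : (- A) u v = - A u v by rewrite mxE.
have scaleE u v t (A : 'M[R]_3) : (t *: A) u v = t * A u v by rewrite mxE.
have mulE u v (A C : 'M[R]_3) : (A *m C) u v =
  A u x_ * C x_ v + A u y_ * C y_ v + A u z_ * C z_ v by rewrite mxE sum3.
have WE a d u v : W a d u v = G u a * (d == v)%:R - G u d * (a == v)%:R.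
  by rewrite mxE.
apply/matrixP => u v; rewrite /K !(addE, oppE, scaleE, mulE, WE, BE) /dtau /cu.
move: u v; apply: ord3P; apply: ord3P; move: i l; apply: ord3P; apply: ord3P => /=;
  rewrite ?Gyx ?Gzx ?Gzy ?Gxz ?Gyz ?cE; by field.
Qed.

Section Isometry.
Variables (f : H3 -> H3) (sf : smooth f).
Hypothesis pf : preserves (linv_metric G) f.
Local Notation M := (frame_jac f).

Let sM : smooth_entries M. Proof. exact: smooth_frame_jac. Qed.

Let MGM p : M p *m G *m (M p)^T = G.
Proof.
have := (pulls_back_jac _ _ sf).1 pf p.
rewrite /linv_metric !invmx_frame /frame_jac => H.
have fK : frame p *m frame (- p) = 1%:M by rewrite frameD subrr frame0.
transitivity (frame p *m (jac f p *m (frame (- f p) *m G *m (frame (- f p))^T)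
    *m (jac f p)^T) *m (frame p)^T); first by rewrite !trmx_mul !mulmxA.
by rewrite H !mulmxA fK mul1mx -mulmxA -trmx_mul fK trmx1 mulmx1.
Qed.

Local Opaque frame_jac.

Let Mu p : M p \in unitmx.
Proof. by have := Gu; rewrite -(MGM p) !unitmx_mul => /andP[/andP[]]. Qed.

(** The connection at [f p] in the direction of the image of X_i. *)
Let N i p := \sum_d M p i d *: B d.

(** This says that [f] carries the Levi-Civita connection to itself. The defect [E] is symmetric
    because both connections are torsion-free and [f] respects the structure equations, and
    antisymmetric because both are metric. *)
Let DM i p : along_mx (frame_field i) M p = B i *m M p - M p *m N i p.
Proof.
pose E i := along_mx (frame_field i) M p - B i *m M p + M p *m N i p.
suff E0 : E i = 0.
  by move/eqP: E0; rewrite addr_eq0 subr_eq => /eqP ->; rewrite addrC.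
apply: (@koszul_eq0 _ _ G (M p) E Gu (Mu p)).
- move=> a b; apply/rowP => j.
  have MN k l : (M p *m N k p) l j = \sum_r \sum_d M p l r * M p k d * B d r j.
    have NE r : N k p r j = \sum_d M p k d * B d r j.
      by rewrite /N summxE; apply: eq_bigr => d _; rewrite [LHS]mxE.
    rewrite mxE; apply: eq_bigr => r _; rewrite NE mulr_sumr.
    by apply: eq_bigr => d _; rewrite mulrA.
  have BM k l : (B k *m M p) l j = \sum_r B k l r * M p r j by rewrite mxE.
  have T := frame_jac_torsion sf a b j p.
  have EE k l : E k l j = along (frame_field k) (fun q => M q l j) p
      - \sum_r B k l r * M p r j + \sum_r \sum_d M p l r * M p k d * B d r j.
    have addE (A C : 'M[R]_3) : (A + C) l j = A l j + C l j by rewrite mxE.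
    have oppE (A : 'M[R]_3) : (- A) l j = - A l j by rewrite mxE.
    by rewrite -MN -BM /E !addE oppE [along_mx _ _ _ _ _]mxE.
  rewrite mxE [RHS]mxE !EE.
  have -> : along (frame_field a) (fun q => M q b j) p =
    along (frame_field b) (fun q => M q a j) p + (2 * dtau a b * M p z_ j -
     (j == z_)%:R * (M p a x_ * M p b y_ - M p a y_ * M p b x_)).
    by rewrite -T addrC subrK.
  move: (along _ _ p) => t.
  have Ba r : B a b r = B b a r + 2 * dtau a b * (r == z_)%:R.
    by rewrite -B_sym addrC subrK.
  have Bd d r : B d r j = B r d j + 2 * dtau d r * (j == z_)%:R.
    by rewrite -B_sym addrC subrK.
  rewrite !sum3 !Ba.
  rewrite (Bd y_ x_) (Bd z_ x_) (Bd z_ y_) /dtau /=; by field.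
- move=> a; rewrite /E mulmxDl mulmxBl mulmxDl mulmxBl.
  have A1 := along_mx_isometry (frame_field a) p Gsym sM MGM.
  have A2 : B a *m M p *m G *m (M p)^T = B a *m G.
    by rewrite -[in RHS](MGM p) !mulmxA.
  have A3 : N a p *m G = - (N a p *m G)^T.
    rewrite /N mulmx_suml linear_sum -sumrN; apply: eq_bigr => d _.
    by rewrite -scalemxAl linearZ -scalerN -B_anti.
  have conj_anti (A Q : 'M[R]_3) : Q = - Q^T -> A *m Q *m A^T = - (A *m Q *m A^T)^T.
    by move=> QT; rewrite {1}QT mulmxN mulNmx !trmx_mul trmxK mulmxA.
  have A4 : M p *m N a p *m G *m (M p)^T = - (M p *m N a p *m G *m (M p)^T)^T.
    rewrite -(mulmxA (M p)); move: (N a p *m G) A3 => Q QT.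
    exact: conj_anti.
  have A2T : B a *m M p *m G *m (M p)^T = - (B a *m M p *m G *m (M p)^T)^T.
    by rewrite A2; exact: B_anti.
  have sum_anti (U V Y : 'M[R]_3) : U = - U^T -> V = - V^T -> Y = - Y^T ->
      U - V + Y = - (U - V + Y)^T.
    move=> UT VT YT; rewrite {1}UT {1}VT {1}YT.
    by rewrite [in RHS]linearD [in RHS]linearB /= !opprD !opprK.
  exact: sum_anti.
Qed.

(** The coefficient of X_3 in the Lie bracket of rows [i] and [l] of [M p]. *)
Let omega i l p := M p i x_ * M p l y_ - M p i y_ * M p l x_.

(** The integrability condition of [DM]: its second derivatives [S] must satisfy the commutation
    relation of the frame. The right-hand side is the curvature at [f p] on the images of X_i and
    X_l. *)
Let curvature_invariance i l p :
  K i l *m M p = M p *m (N i p *m N l p - N l p *m N i p - omega l i p *: B z_).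
Proof.
pose P a := along_mx (frame_field a) M p.
pose T a b := \sum_d P a b d *: B d.
pose S a b := \matrix_(j, k)
  along (frame_field a) (along (frame_field b) (fun q => M q j k)) p.
have PE a u v : P a u v = along (frame_field a) (fun q => M q u v) p.
  by rewrite [LHS]mxE.
have SE a b : S a b = B b *m P a - P a *m N b p - M p *m T a b.
  apply/matrixP => j k.
  have DMe : along (frame_field b) (fun q => M q j k) = fun q =>
      \sum_r B b j r * M q r k + (-1) * (\sum_r M q j r * (\sum_d M q b d * B d r k)).
    apply/funext => q; have /matrixP/(_ j k) := DM b q.
    rewrite [LHS]mxE => ->; rewrite [LHS]mxE [X in X + _]mxE [X in _ + X]mxE mulN1r.
    congr (_ - _); rewrite mxE; apply: eq_bigr => r _; congr (_ * _).
    by rewrite /N summxE; apply: eq_bigr => d _; rewrite [LHS]mxE.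
  have s0 (x : R) : smooth (fun _ : H3 => x) by exact: smooth_cst.
  have sN r : smooth (fun q => \sum_d M q b d * B d r k).
    by apply: smooth_sum => d; exact: smoothM.
  have sMN r : smooth (fun q => M q j r * \sum_d M q b d * B d r k).
    exact: smoothM.
  have sBM r : smooth (fun q => B b j r * M q r k) by exact: smoothM.
  have addE (A C : 'M[R]_3) : (A + C) j k = A j k + C j k by rewrite mxE.
  have oppE (A : 'M[R]_3) : (- A) j k = - A j k by rewrite mxE.
  rewrite !addE !oppE [LHS]mxE DMe alongD; last first.
  - by apply: smoothM => //; exact: smooth_sum.
  - exact: smooth_sum.
  rewrite alongM//; last exact: smooth_sum.
  rewrite along_cst mul0r add0r mulN1r !along_sum// -addrA -opprD; congr (_ - _).
    rewrite mxE; apply: eq_bigr => r _.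
    by rewrite alongM// along_cst mul0r add0r -PE.
  rewrite [X in _ = X + _]mxE [X in _ = _ + X]mxE -big_split; apply: eq_bigr => r _ /=.
  rewrite alongM// -PE along_sum; last by move=> d; exact: smoothM.
  have NE : N b p r k = \sum_d M p b d * B d r k.
    by rewrite /N summxE; apply: eq_bigr => d _; rewrite [LHS]mxE.
  have TE : T a b r k = \sum_d P a b d * B d r k.
    by rewrite /T summxE; apply: eq_bigr => d _; rewrite [LHS]mxE.
  rewrite NE TE; congr (_ + _ * _); apply: eq_bigr => d _.
  by rewrite alongM// along_cst mulr0 addr0 -PE.
have SC : S l i - S i l = (2 * dtau l i) *: P z_.
  apply/matrixP => j k; rewrite !mxE along_frame_commutator//.
(* The structure equations control the antisymmetric part of the terms where [N] is differentiated;
   the symmetric part cancels. *)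
have TC : T l i = T i l + ((2 * dtau l i) *: N z_ p - omega l i p *: B z_).
  have PC d : P l i d = P i l d +
      (2 * dtau l i * M p z_ d - (d == z_)%:R * omega l i p).
    have := frame_jac_torsion sf l i d p.
    by rewrite !PE => <-; rewrite addrC subrK.
  rewrite /T; under eq_bigr do rewrite PC scalerDl scalerBl.
  rewrite big_split/= sumrB; congr (_ + (_ - _)).
    by rewrite /N scaler_sumr; apply: eq_bigr => d _; rewrite scalerA.
  by rewrite sum3 /= !mul0r !scale0r !add0r mul1r.
move: SC; rewrite !SE TC [P z_]DM /P (DM i p) (DM l p) /K.
move: (N i p) (N l p) (N z_ p) (M p) (T i l) (B i) (B l) (B z_).
move: (2 * dtau l i) (omega l i p) => e w.
move=> Ni Nl Nz m t Bi Bl Bz.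
rewrite !(mulmxDl, mulmxDr, mulmxN, mulNmx) -!(scalemxAr, scalemxAl) !mulmxA.
rewrite scalerDr scalerN.
move=> /matrixP H; apply/matrixP => u v; have := H u v.
have addE (A C : 'M[R]_3) : (A + C) u v = A u v + C u v by rewrite mxE.
have oppE (A : 'M[R]_3) : (- A) u v = - A u v by rewrite mxE.
by rewrite !(addE, oppE); lra.
Qed.

(** [W i l] sends X_u to <X_u, X_i> X_l - <X_u, X_l> X_i; it is built from the metric alone, so
    every linear isometry respects it. *)
Let W_invariance i l p :
  W i l *m M p = M p *m \sum_d \sum_e (M p i d * M p l e) *: W d e.
Proof.
have addE (A C : 'M[R]_3) u v : (A + C) u v = A u v + C u v by rewrite mxE.
have scaleE t (A : 'M[R]_3) u v : (t *: A) u v = t * A u v by rewrite mxE.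
have mulE (A C : 'M[R]_3) u v : (A *m C) u v =
  A u x_ * C x_ v + A u y_ * C y_ v + A u z_ * C z_ v by rewrite mxE sum3.
have WE a d u v : W a d u v = G u a * (d == v)%:R - G u d * (a == v)%:R.
  by rewrite mxE.
have := MGM p; move: (M p) => m mGm.
have GE u a : G u a = (m *m G *m m^T) u a by rewrite mGm.
apply/matrixP => u v; transitivity (G u i * m l v - G u l * m i v).
  by rewrite mulE !WE; move: i l; apply: ord3P; apply: ord3P; rewrite /=; ring.
rewrite (GE u i) (GE u l) !mulmx3E !trmxE !sum3 mulE !(addE, scaleE, WE).
by move: v; apply: ord3P; rewrite /=; ring.
Qed.

(** [K i z_] has no plane part because [dtau i z_ = 0]. Once the [W] parts match by [W_invariance],
    the plane part at the target, which is [omega i z_ p] times [W x_ y_], must vanish. *)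
Let omega_center_eq0 i p : i != z_ -> omega i z_ p = 0.
Proof.
move=> iz; have dz0 : dtau i z_ = 0 :> R by rewrite /dtau /=; ring.
have dz0' : dtau z_ i = 0 :> R by rewrite dtauN dz0 oppr0.
have := curvature_invariance i z_ p.
have -> : N i p *m N z_ p - N z_ p *m N i p - omega z_ i p *: B z_ =
    \sum_d \sum_e (M p i d * M p z_ e) *: K d e.
  have -> : omega z_ i p = \sum_d \sum_e (M p i d * M p z_ e) * (2 * dtau e d).
    by rewrite /omega !sum3 /dtau /=; field.
  have NN a b : N a p *m N b p = \sum_d \sum_e (M p a d * M p b e) *: (B d *m B e).
    rewrite /N mulmx_suml; apply: eq_bigr => d _.
    rewrite mulmx_sumr; apply: eq_bigr => e _.
    by rewrite -scalemxAl -scalemxAr scalerA.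
  rewrite !NN [X in _ - X - _]exchange_big scaler_suml -!sumrB; apply: eq_bigr => d _.
  rewrite scaler_suml -!sumrB; apply: eq_bigr => e _ /=.
  by rewrite /K !scalerBr scalerA [M p z_ e * _]mulrC.
have -> : \sum_d \sum_e (M p i d * M p z_ e) *: K d e =
    (- 4^-1) *: (\sum_d \sum_e (M p i d * M p z_ e) *: W d e) +
    omega i z_ p *: W x_ y_.
  have -> : omega i z_ p = \sum_d \sum_e (M p i d * M p z_ e) * (2 * dtau d e).
    by rewrite /omega !sum3 /dtau /=; field.
  rewrite scaler_sumr scaler_suml -big_split; apply: eq_bigr => d _ /=.
  rewrite scaler_sumr scaler_suml -big_split; apply: eq_bigr => e _ /=.
  by rewrite KE scalerDr !scalerA [_ * - 4^-1]mulrC.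
rewrite KE dz0 mulr0 scale0r addr0 mulmxDr -scalemxAl W_invariance -scalemxAr.
rewrite -{1}[X in X = _]addr0 => /addrI/esym; rewrite -scalemxAr => MW.
apply/eqP; apply: contraT => om0.
(* The entries [x_ y_] and [x_ x_] of this matrix are [G x_ x_] and [- G x_ y_]; both being zero
   contradicts [Gdet]. *)
have W0 : W x_ y_ = 0.
  by rewrite -(mulKmx (Mu p) (W x_ y_)) -[M p *m _](scalerK om0) MW scaler0 mulmx0.
have := Gdet.
have /matrixP W0e := W0; have := W0e x_ x_; have := W0e x_ y_.
rewrite !mxE /= => Wxy Wxx.
have -> : G x_ x_ = 0 by lra.
have -> : G x_ y_ = 0 by lra.
by lra.
Qed.

Let third_row p : M p z_ x_ = 0 /\ M p z_ y_ = 0.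
Proof.
have ox := omega_center_eq0 p (isT : x_ != z_).
have oy := omega_center_eq0 p (isT : y_ != z_).
(* The third entry is the default 0. Entry [l] of [M p *m w] is [omega l z_ p], so [w] is in the
   kernel of an invertible matrix. *)
pose w : 'cV[R]_3 := \col_k nth 0 [:: M p z_ y_; - M p z_ x_] k.
have wE k : w k 0 = nth 0 [:: M p z_ y_; - M p z_ x_] k by rewrite [LHS]mxE.
have w0 k : w k 0 = 0.
  rewrite -(mulKmx (Mu p) w); suff -> : M p *m w = 0 by rewrite mulmx0 mxE.
  apply/colP => l; rewrite [LHS]mxE sum3 !wE [RHS]mxE; move: l; apply: ord3P => /=.
  - by rewrite -[RHS]ox /omega; ring.
  - by rewrite -[RHS]oy /omega; ring.
  - by ring.
have := w0 y_; have := w0 x_; rewrite !wE /= => -> /eqP.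
by rewrite oppr_eq0 => /eqP.
Qed.

(** Preserving the line of X_3, [M] also preserves its orthogonal plane. *)
Let third_col p : M p x_ z_ = 0 /\ M p y_ z_ = 0.
Proof.
have [zx zy] := third_row p.
have := MGM p; move: (M p) zx zy => m zx zy mGm.
have E a b : (m *m G *m m^T) a b = G a b by rewrite mGm.
have := E z_ z_; have := E x_ z_; have := E y_ z_.
rewrite !mulmx3E !trmxE zx zy Gxz Gyz Gzx Gzy => yz xz zz.
have {}xz : m x_ z_ * (c * m z_ z_) = 0 by lra.
have {}yz : m y_ z_ * (c * m z_ z_) = 0 by lra.
have mz0 : c * m z_ z_ != 0.
  apply/eqP => e; have c0 : c = 0 by rewrite -zz -[m z_ z_ * c]mulrC e; ring.
  by have := cc; rewrite c0 mul0r => /esym/eqP; rewrite oner_eq0.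
have cancel0 r : r * (c * m z_ z_) = 0 -> r = 0.
  by move/eqP; rewrite mulf_eq0 (negbTE mz0) orbF => /eqP.
by split; exact: cancel0.
Qed.

Let along_M0 i j k : j != z_ -> k != z_ -> forall p,
  along (frame_field i) (fun q => M q j k) p = 0.
Proof.
move=> jz kz p; have M0 b : b != z_ -> M p z_ b = 0.
  by have [zx zy] := third_row p; move: b; apply: ord3P.
have M1 b : b != z_ -> M p b z_ = 0.
  by have [xz yz] := third_col p; move: b; apply: ord3P.
have dM0 b : along (frame_field b) (fun q => M q z_ k) p = 0.
  have -> : (fun q => M q z_ k) = fun=> 0.
    apply/funext => q; have [zx zy] := third_row q.
    by move: k kz; apply: ord3P.
  exact: along_cst.
(* Along X_3 the structure equation gives the result, since row [z_] of [M] vanishes in the plane;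
   along X_1 and X_2, [DM] does. *)
have [->|iz] := eqVneq i z_.
  have := frame_jac_torsion sf z_ j k p; rewrite dM0 subr0 => ->.
  by rewrite (negbTE kz) mul0r subr0 {1}/dtau /= !mul0r subr0 mulr0 mulr0 mul0r.
rewrite -[LHS](_ : along_mx (frame_field i) M p j k = _); last by rewrite [LHS]mxE.
rewrite DM.
have BE a b l : B a b l = dtau a b * (l == z_)%:R +
    dtau_up G l a * G z_ b + dtau_up G l b * G z_ a.
  by rewrite [LHS]mxE.
have Gz b : b != z_ -> G z_ b = 0 by move: b; apply: ord3P; rewrite ?Gzx ?Gzy.
have addE (A C : 'M[R]_3) u v : (A + C) u v = A u v + C u v by rewrite mxE.
have oppE (A : 'M[R]_3) u v : (- A) u v = - A u v by rewrite mxE.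
have mulE (A C : 'M[R]_3) u v : (A *m C) u v =
  A u x_ * C x_ v + A u y_ * C y_ v + A u z_ * C z_ v by rewrite mxE sum3.
have NE b l : N i p b l =
    M p i x_ * B x_ b l + M p i y_ * B y_ b l + M p i z_ * B z_ b l.
  have scaleE t (A : 'M[R]_3) u v : (t *: A) u v = t * A u v by rewrite mxE.
  by rewrite /N summxE sum3 !scaleE.
rewrite addE oppE; move: (M p) (N i p) NE M0 M1 => m n NE M0 M1.
rewrite !mulE !NE (M0 k kz) (M1 j jz) (M1 i iz) !BE.
rewrite (negbTE kz) (Gz i iz) (Gz j jz) Gzx Gzy /=; ring.
Qed.

Let M_cst j k : j != z_ -> k != z_ -> forall p, M p j k = M 0 j k.
Proof.
move=> jz kz p; apply: (along_frame_eq0_cst (h := fun q => M q j k)).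
  exact: sM.
by move=> i q; exact: along_M0.
Qed.

(** The structure equation for X_1, X_2: the bracket of their images is the plane determinant times
    X_3. *)
Let M_zz p : M p z_ z_ = M 0 x_ x_ * M 0 y_ y_ - M 0 x_ y_ * M 0 y_ x_.
Proof.
have := frame_jac_torsion sf x_ y_ z_ p.
have M0 a : a != z_ -> (fun q => M q a z_) = fun=> 0.
  move=> az; apply/funext => q; have [xz yz] := third_col q.
  by move: a az; apply: ord3P.
rewrite !M0// !along_cst subr0 {1}/dtau /= -!(M_cst _ _ p)//; lra.
Qed.

Lemma isometry_linear : f 0 = 0 -> let A := jac f 0 in forall q,
  [/\ f q 0 x_ = q 0 x_ * A x_ x_ + q 0 y_ * A y_ x_,
      f q 0 y_ = q 0 x_ * A x_ y_ + q 0 y_ * A y_ y_ &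
      f q 0 z_ = (A x_ x_ * A y_ y_ - A x_ y_ * A y_ x_) * q 0 z_].
Proof.
move=> f0 A; have M0 := frame_jac0 f0.
pose fc (j : 'I_3) q : R := f q 0 j.
have sfc j : smooth (fc j) by exact: (smooth_rowP _).1.
have fc0 j : fc j 0 = 0 by rewrite /fc f0 mxE.
have DME i j p : M p i j = D i (fc j) p +
  (j == z_)%:R * 2^-1 * (fc y_ p * D i (fc x_) p - fc x_ p * D i (fc y_) p).
  exact: frame_jacE.
pose d := A x_ x_ * A y_ y_ - A x_ y_ * A y_ x_.
have Dh i j p : j != z_ -> D i (fc j) p = (i != z_)%:R * A i j.
  move=> jz; have := DME i j p; rewrite (negbTE jz) !mul0r addr0 => <-.
  have [->|iz] := eqVneq i z_; last by rewrite mul1r M_cst// M0.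
  rewrite mul0r; have [zx zy] := third_row p.
  by move: j jz; apply: ord3P.
have plane j : j != z_ -> forall p, fc j p = p 0 x_ * A x_ j + p 0 y_ * A y_ j.
  move=> jz; suff H : fc j = fun p => p 0 x_ * A x_ j + p 0 y_ * A y_ j by rewrite H.
  apply: eq_partial => //; first by prove_smooth.
    by rewrite fc0 !mxE !mul0r addr0.
  move=> i p; rewrite partial_along_frame !Dh//= mul0r mulr0 addr0.
  rewrite partialD; [|by prove_smooth..].
  rewrite !partialM; [|by prove_smooth..].
  rewrite !partial_cst !partial_coord !mulr0 !add0r.
  by move: i; apply: ord3P; rewrite /=; ring.
have vert p : fc z_ p = d * p 0 z_.
  suff H : fc z_ = fun p => d * p 0 z_ by rewrite H.
  apply: eq_partial => //; first by prove_smooth.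
    by rewrite fc0 mxE mulr0.
  (* For the linear plane part the contact correction is [d * tau p' i], which cancels the [tau]
     term of [partial_along_frame]. *)
  move=> i p'; rewrite partialZ ?partial_coord; last by prove_smooth.
  have Dz a : D a (fc z_) p' = M p' a z_ -
      2^-1 * (fc y_ p' * D a (fc x_) p' - fc x_ p' * D a (fc y_) p').
    by rewrite DME /=; ring.
  have [xz yz] := third_col p'.
  rewrite partial_along_frame !Dz !Dh// !plane// M_zz M0 /tau.
  move: i; apply: ord3P; rewrite /= ?xz ?yz ?M_zz ?M0 -?/A /d; by field.
by move=> q; split; [exact: plane|exact: plane|exact: vert].
Qed.

End Isometry.

End NondegenerateCenter.

(** * Isotropy by group automorphisms, and normality of the translations *)

Section NondegenerateCenterIsometries.
Context {R : realType}.
Local Notation H3 := 'rV[R]_3.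
Local Notation x_ := (@Ordinal 3 0 isT).
Local Notation y_ := (@Ordinal 3 1 isT).
Local Notation z_ := (@Ordinal 3 2 isT).
Local Notation x2 := (@Ordinal 2 0 isT).
Local Notation y2 := (@Ordinal 2 1 isT).

Lemma ord2P (P : 'I_2 -> Prop) : P x2 -> P y2 -> forall i, P i.
Proof.
move=> Px Py [[|[|//]] lti].
- by rewrite (_ : Ordinal _ = x2) //; apply/val_inj.
- by rewrite (_ : Ordinal _ = y2) //; apply/val_inj.
Qed.

Lemma sum2 (V : nmodType) (F : 'I_2 -> V) : \sum_i F i = F x2 + F y2.
Proof.
rewrite !big_ord_recl big_ord0 addr0.
by congr (F _ + F _); apply/val_inj.
Qed.

Lemma det_mx2 (N : 'M[R]_2) : \det N = N x2 x2 * N y2 y2 - N x2 y2 * N y2 x2.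
Proof.
rewrite (expand_det_row _ x2) sum2 /cofactor !det_mx11 !mxE /= addn0 expr0 expr1.
rewrite mul1r mulN1r mulrN; congr (_ * N _ _ - _ * N _ _); exact/val_inj.
Qed.

(** The block sum of [N] and [t], listed by entries so that they compute at concrete indices. *)
Definition dsum (N : 'M[R]_2) (t : R) : 'M[R]_3 := \matrix_(i, j) nth 0 (nth [::]
  [:: [:: N x2 x2; N x2 y2; 0]; [:: N y2 x2; N y2 y2; 0]; [:: 0; 0; t]] i) j.

Lemma dsumE N t i j : dsum N t i j = nth 0 (nth [::]
  [:: [:: N x2 x2; N x2 y2; 0]; [:: N y2 x2; N y2 y2; 0]; [:: 0; 0; t]] i) j.
Proof. by rewrite mxE. Qed.

Lemma dsumM N N' s t : dsum (N *m N') (s * t) = dsum N s *m dsum N' t.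
Proof.
apply/matrixP => i j; rewrite [RHS]mxE sum3 !dsumE.
by move: i j; apply: ord3P; apply: ord3P; rewrite /= ?mxE ?sum2; ring.
Qed.

Lemma dsumT N t : (dsum N t)^T = dsum N^T t.
Proof.
apply/matrixP => i j; rewrite [LHS]mxE !dsumE.
by move: i j; apply: ord3P; apply: ord3P; rewrite /= ?mxE.
Qed.

Lemma dsum1 : dsum 1%:M 1 = 1%:M.
Proof.
apply/matrixP => i j; rewrite dsumE.
by move: i j; apply: ord3P; apply: ord3P; rewrite /= !mxE.
Qed.

Definition top2 (A : 'M[R]_3) : 'M[R]_2 := \matrix_(i, j)
  A (widen_ord (isT : 2 <= 3)%N i) (widen_ord (isT : 2 <= 3)%N j).

Lemma top2E A : [/\ top2 A x2 x2 = A x_ x_, top2 A x2 y2 = A x_ y_,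
  top2 A y2 x2 = A y_ x_ & top2 A y2 y2 = A y_ y_].
Proof. by split; rewrite mxE; congr (A _ _); exact/val_inj. Qed.

Lemma dsumK N t : top2 (dsum N t) = N.
Proof.
have [xx xy yx yy] := top2E (dsum N t); apply/matrixP.
by apply: ord2P; apply: ord2P; rewrite ?xx ?xy ?yx ?yy dsumE.
Qed.

(* The automorphism of the Heisenberg group that extends N. *)
Definition aut_mx (N : 'M[R]_2) := dsum N (\det N).

Lemma aut_mxM N N' : aut_mx (N *m N') = aut_mx N *m aut_mx N'.
Proof. by rewrite /aut_mx det_mulmx dsumM. Qed.

Lemma aut_mx1 : aut_mx 1%:M = 1%:M.
Proof. by rewrite /aut_mx det1 dsum1. Qed.

(** [N] multiplies [area] by its determinant, which is the factor by which [aut_mx N] scales the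
    center. *)
Lemma frame_aut_mx N (p : H3) :
  frame p *m aut_mx N = aut_mx N *m frame (p *m aut_mx N).
Proof.
apply/matrixP => i j; rewrite !mxE !sum3 !frameE /tau.
rewrite ![(p *m _) _ _]mxE !sum3 /aut_mx !dsumE det_mx2.
by move: i j; apply: ord3P; apply: ord3P => /=; field.
Qed.

Lemma mulH_aut_mx N (a q : H3) :
  mulH a q *m aut_mx N = mulH (a *m aut_mx N) (q *m aut_mx N).
Proof.
by rewrite !mulH_frame mulmxDl -!mulmxA frame_aut_mx.
Qed.

(** [S] is the standard form of the plane metric [eta], and the rows of [Q] are the images of X_1
    and X_2 in coordinates adapted to [S]. *)
Variables (S Q : 'M[R]_2) (c : R).
Hypotheses (Ssym : S^T = S) (SS : S *m S = 1%:M) (Qu : Q \in unitmx).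
Let eta := Q *m S *m Q^T.
Let G := dsum eta c.
Hypotheses (GG : G *m G = 1%:M) (cdet : c * \det eta = - 1).
Local Notation g := (linv_metric G).

Let Gsym : G^T = G.
Proof. by rewrite dsumT /eta !trmx_mul trmxK Ssym mulmxA. Qed.

Let Gu : G \in unitmx. Proof. by case/mulmx1_unit: GG. Qed.

Let gl : left_invariant g. Proof. exact: linv_metric_left_invariant. Qed.

(** The transpose reverses products, as does the action on rows, so [Phi] below is a
    homomorphism. *)
Let conj (A : 'M[R]_2) := Q *m A^T *m invmx Q.

Let conjM A B : conj (A *m B) = conj B *m conj A.
Proof. by rewrite /conj trmx_mul !mulmxA mulmxKV. Qed.

Let Phi (A : 'M[R]_2) (q : H3) : H3 := q *m aut_mx (conj A).

Let PhiM A B : Phi (A *m B) = Phi A \o Phi B.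
Proof. by apply/funext => q /=; rewrite /Phi conjM aut_mxM mulmxA. Qed.

Let Phi1 : Phi 1%:M = id.
Proof.
by apply/funext => q; rewrite /Phi /conj trmx1 mulmx1 mulmxV// aut_mx1 mulmx1.
Qed.

Let smooth_Phi A : smooth (Phi A).
Proof. exact: smooth_mulmxr. Qed.

Let conj_eta A : orthogonal_group S A -> conj A *m eta *m (conj A)^T = eta.
Proof.
move=> /(orthogonal_tr SS) AS; rewrite /conj /eta !trmx_mul trmxK trmx_inv !mulmxA.
rewrite mulmxKV// -[_ *m Q^T *m _]mulmxA mulmxV ?unitmx_tr// mulmx1.
by rewrite -!mulmxA (mulmxA A^T) (mulmxA (A^T *m S)) AS !mulmxA.
Qed.

(** An isometry of [eta] has determinant of square 1, so the induced scaling of the center preserves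
    [c]. *)
Let aut_mx_metric N : N *m eta *m N^T = eta ->
  aut_mx N *m G *m (aut_mx N)^T = G.
Proof.
move=> NE; have dN : \det N * c * \det N = c.
  have de0 : \det eta != 0.
    apply/eqP => e; move: cdet.
    by rewrite e mulr0 => /esym/eqP; rewrite oppr_eq0 oner_eq0.
  apply: (mulIf de0).
  by rewrite -[in RHS]NE (det_mulmx (N *m eta)) (det_mulmx N) det_tr; ring.
by rewrite /aut_mx /G dsumT -!dsumM NE dN.
Qed.

Let preserves_aut_mx N : N *m eta *m N^T = eta ->
  preserves g (fun q => q *m aut_mx N).
Proof.
move=> /aut_mx_metric LG; apply/(pulls_back_jac _ _ (smooth_mulmxr _)) => p.
rewrite jac_mulmxr /linv_metric; set L := aut_mx N.
have LF : L *m invmx (frame (p *m L)) = invmx (frame p) *m L.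
  apply: (can_inj (mulKmx (frame_unit p))); rewrite mulKVmx ?frame_unit// mulmxA.
  by rewrite frame_aut_mx mulmxK ?frame_unit.
move: (invmx (frame (p *m L))) (invmx (frame p)) LF => F F0 LF.
transitivity ((L *m F) *m G *m (L *m F)^T); first by rewrite trmx_mul !mulmxA.
by rewrite LF -[in RHS]LG trmx_mul !mulmxA.
Qed.

Let isotropy_Phi A : orthogonal_group S A -> isotropy g (Phi A).
Proof.
move=> AS; have Au := orthogonal_unit SS AS.
split; last by rewrite /Phi mul0mx.
split; [exact: smooth_Phi|exact: preserves_aut_mx (conj_eta AS)|].
exists (Phi (invmx A)); first exact: smooth_Phi.
by split=> q; rewrite -[LHS]/((_ \o _) q) -PhiM ?mulVmx ?mulmxV ?Phi1.
Qed.

(** [Phi A] is linear, so its values on the basis give its matrix; the plane block is [conj A], and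
    the conjugation is undone. *)
Let ext (f : H3 -> H3) : 'M[R]_2 := (invmx Q *m
  top2 (\matrix_i mulH (- f 0) (f (delta_mx 0 i))) *m Q)^T.

Let extK a A : ext (mulH a \o Phi A) = A.
Proof.
rewrite /ext (_ : \matrix_i _ = aut_mx (conj A)).
  by rewrite dsumK /conj !mulmxA mulVmx// mul1mx mulmxKV// trmxK.
apply/row_matrixP => i; rewrite rowK /= {1}/Phi mul0mx mulH0 mulHK.
by rewrite /Phi -rowE.
Qed.

Let cont_ext : continuous (ext : {compact-open, H3 -> H3} -> 'M[R]_2).
Proof.
apply: continuous_mxP => i j.
pose T (f : {compact-open, H3 -> H3}) :=
  top2 (\matrix_i mulH (- f 0) (f (delta_mx 0 i))).
have -> : (fun f => ext f i j) = (fun f => (invmx Q *m T f *m Q) j i).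
  by apply/funext => f; rewrite [LHS]mxE.
apply: continuous_entry; apply: continuous_mulmx; last exact: cst_continuous.
apply: continuous_mulmx; first exact: cst_continuous.
apply: continuous_mxP => k l.
pose i3 := widen_ord (isT : 2 <= 3)%N k; pose j3 := widen_ord (isT : 2 <= 3)%N l.
have -> : (fun f => T f k l) = (fun f => mulH (- f 0) (f (delta_mx 0 i3)) 0 j3).
  by apply/funext => f; rewrite /T [LHS]mxE [LHS]mxE.
apply: continuous_entry; apply: continuous_mulH; last exact: eval_continuous.
move=> f; apply: (@continuousN R H3); exact: eval_continuous.
Qed.

Let cont_Phi : continuous (fun z : 'M[R]_2 * H3 => Phi z.1 z.2).
Proof.
apply: continuous_mulmx; first exact: continuous_snd.
have c1 : continuous (fun z : 'M[R]_2 * H3 => conj z.1).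
  apply: continuous_mulmx; last exact: cst_continuous.
  apply: continuous_mulmx; first exact: cst_continuous.
  apply: continuous_mxP => i j.
  have -> : (fun z : 'M[R]_2 * H3 => (z.1^T) i j) = (fun z => z.1 j i).
    by apply/funext => z; rewrite mxE.
  by apply: continuous_entry; exact: continuous_fst.
have ce i j : continuous (fun z : 'M[R]_2 * H3 => conj z.1 i j).
  exact: continuous_entry.
have c0 : continuous (fun z : 'M[R]_2 * H3 => 0 : R) by exact: cst_continuous.
apply: continuous_mxP => i j.
have -> : (fun z : 'M[R]_2 * H3 => aut_mx (conj z.1) i j) = (fun z =>
   nth 0 (nth [::] [:: [:: conj z.1 x2 x2; conj z.1 x2 y2; 0];
     [:: conj z.1 y2 x2; conj z.1 y2 y2; 0]; [:: 0; 0;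
     conj z.1 x2 x2 * conj z.1 y2 y2 - conj z.1 x2 y2 * conj z.1 y2 x2]] i) j).
  by apply/funext => z; rewrite /aut_mx dsumE det_mx2.
move: i j; apply: ord3P; apply: ord3P => //=.
by apply: continuous_subR; exact: continuous_mulR.
Qed.

Let isotropy_aut_mx f : isotropy g f ->
  exists2 N, N *m eta *m N^T = eta & f = fun q => q *m aut_mx N.
Proof.
move=> [[sf pf _] f0]; pose N := top2 (jac f 0).
have [Nxx Nxy Nyx Nyy] := top2E (jac f 0).
have Gxz : G x_ z_ = 0 by rewrite dsumE.
have Gyz : G y_ z_ = 0 by rewrite dsumE.
have Gdet : G z_ z_ * (G x_ x_ * G y_ y_ - G x_ y_ ^+ 2) = - 1.
  rewrite -cdet det_mx2 /G !dsumE /= expr2; congr (_ * (_ - _ * _)).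
  have etasym : eta^T = eta by rewrite /eta !trmx_mul trmxK Ssym mulmxA.
  by rewrite -[in LHS]etasym mxE.
have fE : f = fun q => q *m aut_mx N.
  apply/funext => q.
  have [fx fy fz] := isometry_linear Gsym GG Gxz Gyz Gdet sf pf f0 q.
  apply: rowH3P; rewrite ?fx ?fy ?fz [RHS]mxE sum3 /aut_mx !dsumE /= ?det_mx2 /N
    ?Nxx ?Nxy ?Nyx ?Nyy; ring.
exists N => //.
have := (pulls_back_jac _ _ sf).1 pf 0.
rewrite f0 linv_metric0 fE jac_mulmxr /aut_mx dsumT -!dsumM => /(congr1 top2).
by rewrite !dsumK.
Qed.

Lemma isometry_semidirect_nondegenerate : isometry_semidirect g (orthogonal_group S).
Proof.
split.
  apply: (isometry_product_intro gl (Phi := Phi) (ext := ext)) => //.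
  split=> //; first by move=> A B _ _ PAB; rewrite -(extK 0 A) -(extK 0 B) PAB.
  move=> f /isotropy_aut_mx[N NE ->].
  exists (invmx Q *m N *m Q)^T.
    rewrite /orthogonal_group /= trmxK; apply: orthogonal_tr => //.
    apply: (can_inj (mulKmx Qu)); apply: (can_inj (@mulmxK _ _ _ Q^T _)).
      by rewrite unitmx_tr.
    rewrite -/eta -NE /eta !trmx_mul trmx_inv !mulmxA mulmxV// mul1mx.
    by rewrite mulmxKV ?unitmx_tr.
  apply/funext => q; rewrite /Phi /conj trmxK; congr (_ *m aut_mx _).
  by rewrite !mulmxA mulmxV// mul1mx mulmxK.
move=> f a fiso.
have [|N _ hE] := @isotropy_aut_mx (mulH (- f 0) \o f).
  split; first by apply: isometries_comp => //; exact: isometries_mulH.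
  by rewrite /= -{2}(mulH0 (f 0)) mulHK.
have fE q : f q = mulH (f 0) (q *m aut_mx N).
  by rewrite -[q *m _]/((fun q => q *m aut_mx N) q) -hE /= mulHKV.
(* With [f] the translation by [f 0] after an automorphism, conjugating the translation by [a] gives
   the translation by the [f 0]-conjugate of the image of [a]. *)
exists (mulH (mulH (f 0) (a *m aut_mx N)) (- f 0)).
apply/funext => q /=; rewrite fE mulH_aut_mx (fE q) -!mulHA.
by rewrite (mulHK (f 0)).
Qed.

End NondegenerateCenterIsometries.

(** * The three isometry groups *)

Section LorentzianMetrics.
Context {R : realType}.
Local Notation H3 := 'rV[R]_3.
Local Notation x_ := (@Ordinal 3 0 isT).
Local Notation y_ := (@Ordinal 3 1 isT).
Local Notation z_ := (@Ordinal 3 2 isT).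
Local Notation x2 := (@Ordinal 2 0 isT).
Local Notation y2 := (@Ordinal 2 1 isT).

(** Translation by [p] has Jacobian [frame p] at 0, so invariance determines [g p] from [g 0]. *)
Lemma left_invariant_linv (g : H3 -> 'M[R]_3) :
  left_invariant g -> g = linv_metric (g 0).
Proof.
move=> gl; apply/funext => p.
have := (pulls_back_jac _ _ (smooth_mulH p)).1 (gl p) 0.
rewrite mulH0 => gE; rewrite -gE /linv_metric.
have -> : jac (mulH p) 0 = frame p.
  apply/row_matrixP => i; rewrite !rowE -diff_jac; last exact: smooth_mulH.
  by rewrite diff_mulH.
have FK := mulVmx (frame_unit p).
by rewrite !mulmxA FK mul1mx -mulmxA -trmx_mul FK trmx1 mulmx1.
Qed.

Lemma flat_isometry_product (g : H3 -> 'M[R]_3) :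
  lorentzian g -> left_invariant g -> flat g ->
  isometry_product g (orthogonal_group (sig_mx 2 1)).
Proof.
move=> [[_ gsu] glor] gl gflat; have gE := left_invariant_linv gl.
have [Gsym Gu] := gsu 0; have [P Pu GP] := glor 0.
rewrite gE in gflat.
have Gzz := flat_linv_metric_center_null Gsym Gu gflat.
have [psi [psii [spsi spsii [psiK psiiK] psi0 psiS]]] :=
  flat_linv_metric_developing Gsym Gu Gzz Pu GP.
rewrite -gE in psiS.
exact: (isometry_product_developing gl (tr_sig_mx 2 1) (sig_mxK 2 1)
  spsi spsii psiK psiiK psi0 psiS).
Qed.

Lemma h1E : @h1 R = linv_metric (dsum (1%:M *m 1%:M *m 1%:M^T) (- 1)).
Proof.
congr linv_metric; rewrite trmx1 !mulmx1; apply/matrixP => i j; rewrite dsumE.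
by move: i j; apply: ord3P; apply: ord3P; rewrite !mxE /=; ring.
Qed.

(* The rows of null_basis are a null basis of the Minkowski plane with Gram
   matrix [[0, 1], [1, 0]]. *)
Definition null_basis : 'M[R]_2 :=
  \matrix_(i, j) nth 0 (nth [::] [:: [:: 1; 1]; [:: 2^-1; - 2^-1]] i) j.

Lemma sig_mx11E i j : (sig_mx 1 1 : 'M[R]_2) i j =
  nth 0 (nth [::] [:: [:: 1; 0]; [:: 0; -1]] i) j.
Proof.
have ul : (sig_mx 1 1 : 'M[R]_(1 + 1)) (lshift 1 0) (lshift 1 0) = 1.
  by rewrite /sig_mx block_mxEul mxE.
have ur : (sig_mx 1 1 : 'M[R]_(1 + 1)) (lshift 1 0) (rshift 1 0) = 0.
  by rewrite /sig_mx block_mxEur mxE.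
have dl : (sig_mx 1 1 : 'M[R]_(1 + 1)) (rshift 1 0) (lshift 1 0) = 0.
  by rewrite /sig_mx block_mxEdl mxE.
have dr : (sig_mx 1 1 : 'M[R]_(1 + 1)) (rshift 1 0) (rshift 1 0) = - 1.
  by rewrite /sig_mx block_mxEdr !mxE.
move: i j; apply: ord2P; apply: ord2P => /=;
  [rewrite -[RHS]ul|rewrite -[RHS]ur|rewrite -[RHS]dl|rewrite -[RHS]dr];
  by congr (sig_mx 1 1 _ _); exact/val_inj.
Qed.

Lemma null_basis_unit : null_basis \in unitmx.
Proof.
rewrite unitmxE det_mx2 !mxE /= unitfE; apply/eqP; lra.
Qed.

Lemma null_basis_gram (k l : 'I_2) :
  (null_basis *m (sig_mx 1 1 : 'M[R]_2) *m null_basis^T) k l =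
  nth 0 (nth [::] [:: [:: 0; 1]; [:: 1; 0]] k) l.
Proof.
rewrite mxE sum2 ![(_ *m _) _ _]mxE !sum2 !sig_mx11E.
by move: k l; apply: ord2P; apply: ord2P; rewrite !mxE /=; field.
Qed.

Lemma h2E : @h2 R =
  linv_metric (dsum (null_basis *m (sig_mx 1 1 : 'M[R]_2) *m null_basis^T) 1).
Proof.
congr linv_metric; apply/matrixP => i j; rewrite dsumE !null_basis_gram.
by move: i j; apply: ord3P; apply: ord3P; rewrite !mxE /=; ring.
Qed.

Lemma h1_semidirect : isometry_semidirect (@h1 R) (orthogonal_group (1%:M : 'M[R]_2)).
Proof.
rewrite h1E; apply: isometry_semidirect_nondegenerate.
- exact: trmx1.
- exact: mulmx1.
- exact: unitmx1.
- by rewrite -dsumM trmx1 !mulmx1 mulrNN mulr1 dsum1.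
- by rewrite trmx1 !mulmx1 det1 mulr1.
Qed.

Lemma h2_semidirect :
  isometry_semidirect (@h2 R) (orthogonal_group (sig_mx 1 1 : 'M[R]_2)).
Proof.
have SS : (sig_mx 1 1 : 'M[R]_2) *m sig_mx 1 1 = 1%:M by exact: (@sig_mxK R 1 1).
have ST : (sig_mx 1 1 : 'M[R]_2)^T = sig_mx 1 1 by exact: (@tr_sig_mx R 1 1).
have detS : \det (sig_mx 1 1 : 'M[R]_2) = - 1.
  by rewrite det_mx2 !sig_mx11E /=; ring.
have detN : \det null_basis = - 1 by rewrite det_mx2 !mxE /=; field.
rewrite h2E; apply: isometry_semidirect_nondegenerate => //.
- exact: null_basis_unit.
- rewrite -dsumM mulr1 -dsum1; congr (dsum _ 1).
  apply/matrixP => i j; rewrite mxE sum2 !null_basis_gram.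
  by move: i j; apply: ord2P; apply: ord2P; rewrite !mxE /=; ring.
- by rewrite !det_mulmx det_tr detS detN; ring.
Qed.

Lemma h1_soliton : algebraic_ricci_soliton (@h1 R).
Proof.
apply: soliton_linv.
- by apply/matrixP => i j; rewrite !mxE; move: i j; apply: ord3P; apply: ord3P.
- apply/matrixP => i j; rewrite !mxE sum3 !mxE.
  by move: i j; apply: ord3P; apply: ord3P => /=; ring.
- by rewrite !mxE /=; ring.
- by rewrite !mxE /=; ring.
- by rewrite !mxE /=; ring.
Qed.

Lemma h2_soliton : algebraic_ricci_soliton (@h2 R).
Proof.
apply: soliton_linv.
- apply/matrixP => i j; rewrite !mxE.
  by move: i j; apply: ord3P; apply: ord3P => /=; ring.
- apply/matrixP => i j; rewrite !mxE sum3 !mxE.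
  by move: i j; apply: ord3P; apply: ord3P => /=; ring.
- by rewrite !mxE /=; ring.
- by rewrite !mxE /=; ring.
- by rewrite !mxE /=; ring.
Qed.

End LorentzianMetrics.

Theorem proposition3p4 (R : realType) :
  (forall h0 : 'rV[R]_3 -> 'M[R]_3,
     lorentzian h0 -> left_invariant h0 -> flat h0 ->
     isometry_product h0 (orthogonal_group (sig_mx 2 1))) /\
  isometry_semidirect (@h1 R) (orthogonal_group (1%:M : 'M[R]_2)) /\
  isometry_semidirect (@h2 R) (orthogonal_group (sig_mx 1 1)) /\
  algebraic_ricci_soliton (@h1 R) /\ algebraic_ricci_soliton (@h2 R).
Proof.
split; first exact: flat_isometry_product.
split; first exact: h1_semidirect.
split; first exact: h2_semidirect.
by split; [exact: h1_soliton|exact: h2_soliton].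
Qed.
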